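(* Consider the probabilistic PCA setting of the context, and let $\alpha\in(0,1)$. Suppose there exist $K_0\in\{1,\dots,d\}$ and $\mathbf{W}_0\in\mathbb{R}^{d\times K_0}$ with bounded coefficients (i.e. $|(\mathbf{W}_0)_{i,j}|\le C$ for some constant $C$) such that $X_1,\dots,X_n$ are i.i.d. with distribution $P^0=P_{\mathbf{W}_0}$. Then $$\mathbb{E}\Big[\int D_\alpha(P_{\mathbf{W}},P_{\mathbf{W}_0})\,\tilde\pi^{\hat K}_{n,\alpha}(d\mathbf{W}|X_1^n)\Big]=\mathcal{O}\Big(\frac{dK_0\log(dn)}{n}\Big).$$
   Context: Fix $\sigma^2>0$ (known) and $d\ge1$. For $\mathbf{W}\in\mathbb{R}^{d\times K}$, $P_{\mathbf{W}}=\mathcal{N}(0,\mathbf{W}\mathbf{W}^T+\sigma^2\mathbf{I}_d)$. Model $\mathcal{M}_K=\{P_{\mathbf{W}}:\mathbf{W}\in\mathbb{R}^{d\times K}\}$ for $K=1,\dots,d$, with prior weights $\pi_K=1/d$. Conditional prior $\Pi_K$: the columns $W_1,\dots,W_K$ of $\mathbf{W}$ are i.i.d. $\mathcal{N}(0,s^2\mathbf{I}_d)$ for a fixed $s>0$. Variational set $\mathcal{F}_K$: distributions on $\mathbb{R}^{d\times K}$ under which the columns are independent with $W_j\sim\mathcal{N}(\mu_j,\mathbf{\Sigma}_j)$, $\mu_j\in\mathbb{R}^d$, $\mathbf{\Sigma}_j$ positive definite. Log-likelihood $\ell_n(\mathbf{W})=\sum_{i=1}^n\log p_{\mathbf{W}}(X_i)$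 where $p_{\mathbf{W}}$ is the Gaussian density. Variational approximation $\tilde\pi^K_{n,\alpha}(\cdot|X_1^n)=\arg\max_{\rho\in\mathcal{F}_K}\{\alpha\int\ell_n d\rho-\mathrm{KL}(\rho,\Pi_K)\}$ (equivalently the KL-projection onto $\mathcal{F}_K$ of the tempered posterior $\propto e^{\alpha\ell_n}\Pi_K$); $\mathrm{ELBO}(K)$ is the value of this maximum and $\hat K=\arg\max_{K}\{\mathrm{ELBO}(K)-\log(1/\pi_K)\}$. The expectation is over $X_1,\dots,X_n$ i.i.d. $\sim P^0$. Rényi divergence: $D_\alpha(P,R)=\frac1{\alpha-1}\log\int(dP/dR)^{\alpha-1}dP$ if $P\ll R$, $+\infty$ otherwise. $\mathrm{KL}$ is the Kullback–Leibler divergence. *)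

(* Defs.v *)
From HB Require Import structures.
From mathcomp Require Import all_boot all_order all_algebra.
From mathcomp Require Import all_classical all_reals all_analysis.
Set Implicit Arguments. Unset Strict Implicit. Unset Printing Implicit Defensive.
Import Order.TTheory GRing.Theory Num.Theory.
Local Open Scope ring_scope.

Section PPCA.
Variable R : realType.

(* Lebesgue integral over R^m (row vectors), defined as the iterated
   one-dimensional Lebesgue integral (Tonelli/Fubini). *)
Fixpoint intRn (m : nat) : ('rV[R]_m -> \bar R) -> \bar R :=
  match m with
  | 0 => fun f => f 0
  | m'.+1 => fun f =>
      (\int[@lebesgue_measure R]_x intRn (fun v : 'rV[R]_m' => f (row_mx (\row_(j < 1) x) v)))%E
  end.

Definition intM (p q : nat) (f : 'M[R]_(p, q) -> \bar R) : \bar R :=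
  intRn (fun v : 'rV[R]_(p * q) => f (vec_mx v)).

Definition posdef (d : nat) (S : 'M[R]_d) : Prop :=
  S^T = S /\ forall v : 'rV[R]_d, v != 0 -> 0 < (v *m S *m v^T) 0 0.

Definition gauss_pdf (d : nat) (mu : 'rV[R]_d) (S : 'M[R]_d) (x : 'rV[R]_d) : R :=
  (Num.sqrt ((2 * pi) ^+ d * \det S))^-1 *
  expR (- (((x - mu) *m invmx S *m (x - mu)^T) 0 0) / 2).

Definition ppca_cov (sigma2 : R) (d K : nat) (W : 'M[R]_(d, K)) : 'M[R]_d :=
  W *m W^T + sigma2%:M.

Definition ppca_pdf (sigma2 : R) (d K : nat) (W : 'M[R]_(d, K)) : 'rV[R]_d -> R :=
  gauss_pdf 0 (ppca_cov sigma2 W).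

(* Renyi divergence D_alpha(P, Q) for P, Q with everywhere positive densities
   p, q on R^d:  1/(alpha-1) log \int p^alpha q^(1-alpha). *)
Definition renyi (d : nat) (alpha : R) (p q : 'rV[R]_d -> R) : R :=
  (alpha - 1)^-1 *
  ln (fine (intRn (fun x => (p x `^ alpha * q x `^ (1 - alpha))%:E))).

Definition loglik (sigma2 : R) (n d K : nat) (X : 'M[R]_(n, d)) (W : 'M[R]_(d, K)) : R :=
  \sum_(i < n) ln (ppca_pdf sigma2 W (row i X)).

Definition mf_pdf (d K : nat) (mu : 'M[R]_(d, K)) (S : 'I_K -> 'M[R]_d)
  (W : 'M[R]_(d, K)) : R :=
  \prod_(j < K) gauss_pdf (col j mu)^T (S j) (col j W)^T.

Definition prior_pdf (s : R) (d K : nat) (W : 'M[R]_(d, K)) : R :=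
  \prod_(j < K) gauss_pdf 0 ((s ^+ 2)%:M) (col j W)^T.

Definition KLdens (d K : nat) (q p : 'M[R]_(d, K) -> R) : \bar R :=
  intM (fun W => (q W * ln (q W / p W))%:E).

Definition vobj (sigma2 s alpha : R) (n d K : nat) (X : 'M[R]_(n, d))
  (mu : 'M[R]_(d, K)) (S : 'I_K -> 'M[R]_d) : \bar R :=
  (alpha%:E * intM (fun W => (loglik sigma2 X W * mf_pdf mu S W)%:E)
   - KLdens (mf_pdf mu S) (prior_pdf s (K:=K)))%E.

Definition ELBO (sigma2 s alpha : R) (n d K : nat) (X : 'M[R]_(n, d)) : \bar R :=
  ereal_sup [set y | exists (mu : 'M[R]_(d, K)) (S : 'I_K -> 'M[R]_d),
                (forall j, posdef (S j)) /\ y = vobj sigma2 s alpha X mu S].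

End PPCA.

(* Main.v *)
Require Import Defs.
From HB Require Import structures.
From mathcomp Require Import all_boot all_order all_algebra.
From mathcomp Require Import all_classical all_reals all_analysis.
From mathcomp Require Import measurable_realfun ring lra.
Import Order.TTheory GRing.Theory Num.Theory.
Local Open Scope ring_scope.
Set Implicit Arguments. Unset Strict Implicit. Unset Printing Implicit Defensive.

(** For a fixed sample X, let q be the density of the selected variational
approximation, p the prior density, l0 and l(W) the log-likelihoods at W0 and W,
and g(W) = alpha (l(W) - l0) + n (1 - alpha) D_alpha(P_W, P_W0).  The inequality
ln y <= y / d - 1 + ln d, applied to y = p e^g / q and integrated against q, gives
  n (1 - alpha) int D_alpha q <= alpha l0 - ELBO(Khat) + ln d + Z_Khat(X) / d,
where Z_K(X) = int p e^g on the K-th model.  By definition of the Renyi divergence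
and Tonelli's theorem, Z_K has expectation 1 for each K, so replacing Z_Khat by the
sum of the Z_K costs only a constant.

It remains to bound alpha l0 - ELBO(K0) from above, through the member of the
variational family centred at W0 with covariance I / (n d).  With W = W0 + V,
concavity of the log-determinant and the ridge regression characterisation of
x (W W^T + sigma2 I)^-1 x^T bound l0 - l(W) by a linear form in V plus a multiple of
|V|^2.  The Gaussian moments needed are all estimated by exponentials of linear or
quadratic forms, whose integrals are again Gaussian normalisation constants.

The selected K and the variational parameters need not depend measurably on X.  This
is harmless because the integral, defined by suprema over simple functions, is
monotone for arbitrary functions, and the bounds above are measurable in X. *)

(** * Positive definite forms, Schur complements and log-determinants *)

Section quadratic_forms.
Variable R : realType.

(** The logarithm in the Donsker-Varadhan inequality is linearised before any expectation is taken.
    The evidences then enter additively, so the random choice of model is dominated by a sum, and no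
    logarithm of a random integral has to be handled. The scale d is the total expectation of the d
    evidences, so selection costs ln d, as the uniform weights suggest.

    The comparison with the truth is made for a fixed sample, where the linear term of the
    log-likelihood has a random coefficient of arbitrary size. A sufficiently small exponential tilt
    shows that it contributes at most a constant to the Gaussian average. What matters is the
    quadratic coefficient, a multiple of n plus a sum of Mahalanobis forms of the observations.

    Ridge regression is what keeps the constants uniform: the perturbation is controlled by the
    precision form of [W0], never by a norm of [W0]. The bound on the entries of [W0] enters only
    through the prior density.

    Spectral theory is avoided throughout: positive definite matrices are treated by induction on
    the dimension, which also matches the iterated form of the integral. *)

Definition qf (d : nat) (A : 'M[R]_d) (v : 'rV[R]_d) : R := (v *m A *m v^T) 0 0.

Definition sqn (d : nat) (v : 'rV[R]_d) : R := (v *m v^T) 0 0.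

Lemma sqnE d (v : 'rV[R]_d) : sqn v = \sum_i v 0 i ^+ 2.
Proof. by rewrite /sqn mxE; apply: eq_bigr => i _; rewrite mxE expr2. Qed.

Lemma sqn_ge0 d (v : 'rV[R]_d) : 0 <= sqn v.
Proof. by rewrite sqnE sumr_ge0// => i _; rewrite sqr_ge0. Qed.

Lemma sqn_gt0 d (v : 'rV[R]_d) : v != 0 -> 0 < sqn v.
Proof.
move=> v0; rewrite lt_def sqn_ge0 andbT; apply: contra v0.
rewrite sqnE psumr_eq0 => [/allP h|i _]; last exact: sqr_ge0.
apply/eqP/rowP => i; rewrite mxE; apply/eqP.
by have := h i (mem_index_enum i); rewrite sqrf_eq0.
Qed.

Lemma sqn0 d : sqn (0 : 'rV[R]_d) = 0.
Proof. by rewrite /sqn mul0mx mxE. Qed.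

Lemma sqnD_le d (u v : 'rV[R]_d) : sqn (u + v) <= 2 * sqn u + 2 * sqn v.
Proof.
rewrite !sqnE !mulr_sumr -big_split/=; apply: ler_sum => i _; rewrite mxE.
have := sqr_ge0 (u 0 i - v 0 i); nra.
Qed.

Lemma CauchySchwarz_sum (I : finType) (a b : I -> R) :
  (\sum_i a i * b i) ^+ 2 <= (\sum_i a i ^+ 2) * (\sum_i b i ^+ 2).
Proof.
set A := \sum_i a i ^+ 2; set B := \sum_i b i ^+ 2; set D := \sum_i _.
have h t : 0 <= A - 2 * t * D + t ^+ 2 * B.
  rewrite /A /B /D !mulr_sumr -sumrB -big_split/=; apply: sumr_ge0 => i _.
  by have := sqr_ge0 (a i - t * b i); nra.
have B0 : 0 <= B by apply: sumr_ge0 => i _; exact: sqr_ge0.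
have A0 : 0 <= A by apply: sumr_ge0 => i _; exact: sqr_ge0.
have [B00|Bn0] := eqVneq B 0.
  have b0 i : b i = 0.
    move/eqP: B00; rewrite psumr_eq0 => [/allP bb|j _]; last exact: sqr_ge0.
    by have := bb i (mem_index_enum i); rewrite sqrf_eq0 => /eqP.
  rewrite B00 mulr0 /D big1 ?expr0n// => i _; by rewrite b0 mulr0.
have Bp : 0 < B by rewrite lt_def Bn0.
(* The minimiser in [t] of the quadratic polynomial [h]. *)
have := h (D / B).
have -> : A - 2 * (D / B) * D + (D / B) ^+ 2 * B = (A * B - D ^+ 2) / B by field.
by rewrite pmulr_lge0 ?invr_gt0// subr_ge0.
Qed.

Definition frob (p q : nat) (A : 'M[R]_(p, q)) : R := \sum_i \sum_j A i j ^+ 2.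

Lemma frob_ge0 p q (A : 'M[R]_(p, q)) : 0 <= frob A.
Proof. by apply: sumr_ge0 => i _; apply: sumr_ge0 => j _; exact: sqr_ge0. Qed.

Lemma sqn_mulmx_le p q (v : 'rV[R]_p) (A : 'M[R]_(p, q)) :
  sqn (v *m A) <= sqn v * frob A.
Proof.
rewrite /frob exchange_big/= mulr_sumr sqnE; apply: ler_sum => j _.
rewrite mxE sqnE; exact: CauchySchwarz_sum.
Qed.

Lemma frob_tr p q (A : 'M[R]_(p, q)) : frob A^T = frob A.
Proof.
by rewrite /frob exchange_big; apply: eq_bigr => i _; apply: eq_bigr => j _;
  rewrite mxE.
Qed.

Lemma trmx11 (A : 'M[R]_1) : A^T = A.
Proof. by apply/matrixP => i j; rewrite mxE !ord1. Qed.

Lemma qfD d (A : 'M[R]_d) (u v : 'rV[R]_d) : A^T = A ->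
  qf A (u + v) = qf A u + 2 * (u *m A *m v^T) 0 0 + qf A v.
Proof.
move=> sA; rewrite /qf linearD/= !mulmxDl !mulmxDr.
have -> : v *m A *m u^T = u *m A *m v^T.
  by rewrite -[LHS]trmx11 !trmx_mul trmxK sA mulmxA.
rewrite !mxE; ring.
Qed.

Lemma posdef_sym d (S : 'M[R]_d) : posdef S -> S^T = S.
Proof. by case. Qed.

Lemma posdef_qf_gt0 d (S : 'M[R]_d) v : posdef S -> v != 0 -> 0 < qf S v.
Proof. by case=> _ h /h. Qed.

Lemma posdef_qf_ge0 d (S : 'M[R]_d) v : posdef S -> 0 <= qf S v.
Proof.
move=> pS; have [->|v0] := eqVneq v 0; first by rewrite /qf !mul0mx mxE.
exact/ltW/posdef_qf_gt0.
Qed.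

Lemma posdef_unitmx d (S : 'M[R]_d) : posdef S -> S \in unitmx.
Proof.
move=> pS; rewrite -row_free_unit; apply/inj_row_free => v vS.
apply: contraPeq vS => v0 vS; have := posdef_qf_gt0 pS v0.
by rewrite /qf vS mul0mx mxE ltxx.
Qed.

Lemma posdef_scalar d (c : R) : 0 < c -> posdef (c%:M : 'M[R]_d).
Proof.
move=> c0; split; first by rewrite tr_scalar_mx.
move=> v v0; rewrite mul_mx_scalar -scalemxAl mxE.
by rewrite mulr_gt0//; exact: sqn_gt0.
Qed.

Lemma posdefD d (S T : 'M[R]_d) : posdef S -> posdef T -> posdef (S + T).
Proof.
move=> pS pT; split; first by rewrite linearD/= !posdef_sym.
move=> v v0; rewrite mulmxDr mulmxDl mxE addr_gt0//; exact: posdef_qf_gt0.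
Qed.

Lemma posdefZ d (c : R) (S : 'M[R]_d) : 0 < c -> posdef S -> posdef (c *: S).
Proof.
move=> c0 pS; split; first by rewrite linearZ/= posdef_sym.
move=> v v0; rewrite -scalemxAr -scalemxAl mxE mulr_gt0//; exact: posdef_qf_gt0.
Qed.

Lemma posdef_congr d (L S : 'M[R]_d) : L \in unitmx -> posdef S ->
  posdef (L *m S *m L^T).
Proof.
move=> uL pS; split; first by rewrite !trmx_mul trmxK (posdef_sym pS) mulmxA.
move=> v v0; have vL0 : v *m L != 0.
  by apply: contra v0 => /eqP vL; rewrite -(mulmxK uL v) vL mul0mx.
have := posdef_qf_gt0 pS vL0.
by rewrite /qf trmx_mul !mulmxA.
Qed.

Lemma blockmx_sym m (S : 'M[R]_(1 + m)) : S^T = S ->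
  S = block_mx (ulsubmx S) (ursubmx S) (ursubmx S)^T (drsubmx S).
Proof. by move=> sS; rewrite trmx_ursub sS submxK. Qed.

Lemma posdef_drsubmx m (S : 'M[R]_(1 + m)) : posdef S -> posdef (drsubmx S).
Proof.
move=> pS; have sS := posdef_sym pS.
split; first by rewrite trmx_drsub sS.
move=> v v0; have w0 : row_mx (0 : 'rV[R]_1) v != 0.
  by apply: contra v0 => /eqP/(congr1 rsubmx); rewrite row_mxKr linear0 => ->.
have := posdef_qf_gt0 pS w0; rewrite /qf -[S]submxK.
rewrite mul_row_block tr_row_mx mul_row_col block_mxKdr.
by rewrite !mul0mx !add0r trmx0 mulmx0 add0r.
Qed.

(** If [S] is the precision matrix of a Gaussian vector, this is the precision of the marginal law
    of the first coordinate. *)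
Definition schur m (S : 'M[R]_(1 + m)) : R :=
  (ulsubmx S - ursubmx S *m invmx (drsubmx S) *m (ursubmx S)^T) 0 0.

(* Completing the square in the last m coordinates. *)
Lemma qf_schur m (S : 'M[R]_(1 + m)) (x : R) (u : 'rV[R]_m) : posdef S ->
  qf S (row_mx x%:M u) =
  qf (drsubmx S) (u + x *: (ursubmx S *m invmx (drsubmx S))) + schur S * x ^+ 2.
Proof.
move=> pS; have sS := posdef_sym pS; have pQ := posdef_drsubmx pS.
have uQ := posdef_unitmx pQ; have sQ := posdef_sym pQ.
rewrite {1}(blockmx_sym sS) /schur; move: (ulsubmx S) (ursubmx S) => A b.
move: (drsubmx S) pQ uQ sQ => Q pQ uQ sQ.
rewrite qfD// /qf mul_row_block tr_row_mx mul_row_col tr_scalar_mx.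
rewrite linearZ/= trmx_mul trmx_inv sQ.
have -> : u *m Q *m (x *: (invmx Q *m b^T)) = x *: (u *m b^T).
  by rewrite -scalemxAr !mulmxA mulmxK.
have -> : x *: (b *m invmx Q) *m Q *m (x *: (invmx Q *m b^T)) =
    (x * x) *: (b *m invmx Q *m b^T).
  by rewrite -!scalemxAl -scalemxAr scalerA mulmxKV// mulmxA.
rewrite !mul_scalar_mx !mul_mx_scalar mulmxDl -scalemxAl.
have -> : b *m u^T = u *m b^T by rewrite -[LHS]trmx11 trmx_mul trmxK.
rewrite !mxE; ring.
Qed.

Lemma posdef_schur_gt0 m (S : 'M[R]_(1 + m)) : posdef S -> 0 < schur S.
Proof.
move=> pS; set t := ursubmx S *m invmx (drsubmx S).
(* The last coordinates of this vector cancel the square in [qf_schur], so that only the complement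
   remains. *)
have w0 : row_mx (1%:M : 'M[R]_1) (- t) != 0.
  apply/eqP => /(congr1 lsubmx); rewrite row_mxKl linear0 => /matrixP/(_ 0 0).
  by rewrite !mxE eqxx => /eqP; rewrite oner_eq0.
have := posdef_qf_gt0 pS w0; rewrite qf_schur// scale1r addNr.
by rewrite /qf mul0mx mul0mx mxE add0r expr1n mulr1.
Qed.

Lemma schur_le m (S : 'M[R]_(1 + m)) : posdef S -> schur S <= ulsubmx S 0 0.
Proof.
move=> pS; have pQ := posdef_drsubmx pS; have uQ := posdef_unitmx pQ.
rewrite /schur mxE gerDl [_ 0 0]mxE oppr_le0.
have := posdef_qf_ge0 (ursubmx S *m invmx (drsubmx S)) pQ.
by rewrite /qf mulmxKV// trmx_mul trmx_inv posdef_sym// mulmxA.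
Qed.

Lemma det_schur m (S : 'M[R]_(1 + m)) : posdef S ->
  \det S = schur S * \det (drsubmx S).
Proof.
move=> pS; have sS := posdef_sym pS; have pQ := posdef_drsubmx pS.
have uQ := posdef_unitmx pQ.
set A := ulsubmx S; set b := ursubmx S; set Q := drsubmx S.
have SE : S = block_mx 1%:M (b *m invmx Q) 0 1%:M *m
    block_mx (A - b *m invmx Q *m b^T) 0 b^T Q.
  rewrite mulmx_block !mul1mx !mul0mx !add0r subrK mulmxKV//.
  exact: blockmx_sym.
by rewrite [in LHS]SE det_mulmx det_ublock det_lblock !det1 !mul1r det_mx11.
Qed.

Lemma posdef_det_gt0 d (S : 'M[R]_d) : posdef S -> 0 < \det S.
Proof.
elim: d S => [|d IH] S pS; first by rewrite det_mx00.
rewrite (@det_schur d)// mulr_gt0//; first exact: posdef_schur_gt0.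
by apply: IH; exact: (@posdef_drsubmx d).
Qed.

(** The successive Schur complements play the role of eigenvalues: each satisfies ln c <= c - 1 and
    is at most the corresponding diagonal entry. *)
Lemma ln_det_le_trace d (S : 'M[R]_d) : posdef S -> ln (\det S) <= \tr S - d%:R.
Proof.
elim: d S => [|d IH] S pS.
  by rewrite det_mx00 ln1 /mxtrace big_ord0 subrr.
have pQ : posdef (drsubmx (S : 'M[R]_(1 + d))) by exact: posdef_drsubmx.
have c0 : 0 < schur (S : 'M[R]_(1 + d)) by exact: posdef_schur_gt0.
rewrite (@det_schur d)// lnM ?posrE ?posdef_det_gt0//.
have -> : \tr S = ulsubmx (S : 'M[R]_(1 + d)) 0 0 + \tr (drsubmx (S : 'M[R]_(1 + d))).
  rewrite -[in LHS](submxK (S : 'M[R]_(1 + d))).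
  by rewrite (@mxtrace_block R 1 d) trace_mx11.
have h1 : ln (schur (S : 'M[R]_(1 + d))) <= schur (S : 'M[R]_(1 + d)) - 1.
  have e := @expR_ge1Dx R (ln (schur (S : 'M[R]_(1 + d)))).
  by rewrite lnK ?posrE// in e; lra.
have h2 := schur_le pS; have h3 := IH _ pQ.
rewrite -natr1; lra.
Qed.

(** One step of an inverse Cholesky factorisation: the new first row is the direction orthogonal,
    for [S], to the last coordinates, divided by the square root of the Schur complement. *)
Lemma posdef_whitening_step d (S : 'M[R]_(1 + d)) (L : 'M[R]_d) : posdef S ->
  L \in unitmx -> L *m drsubmx S *m L^T = 1%:M ->
  exists2 N : 'M[R]_(1 + d), N \in unitmx & N *m S *m N^T = 1%:M.
Proof.
move=> pS uL LQL; have pQ := posdef_drsubmx pS.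
have sS := posdef_sym pS.
have c0 := posdef_schur_gt0 pS; set r := (Num.sqrt (schur S))^-1.
have sq0 : 0 < Num.sqrt (schur S) by rewrite sqrtr_gt0.
have rr : r * r * schur S = 1.
  by rewrite -{1}(sqr_sqrtr (ltW c0)) /r; field; rewrite gt_eqF.
move: rr; rewrite /schur.
set b := ursubmx S; set Q := drsubmx S in pQ LQL *; set A := ulsubmx S => rr.
have uQ := posdef_unitmx pQ.
exists (block_mx r%:M (- r *: (b *m invmx Q)) 0 L).
  rewrite unitmxE det_ublock det_mx11 mxE eqxx mulr1n unitrM.
  by rewrite -unitmxE uL andbT unitfE invr_neq0// gt_eqF.
rewrite (blockmx_sym sS) -/b -/Q -/A.
rewrite [X in _ *m X](_ : _ = block_mx r%:M 0 (- r *: (invmx Q *m b^T)) L^T);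
  last first.
  rewrite tr_block_mx tr_scalar_mx trmx0 linearZ/= trmx_mul trmx_inv.
  by rewrite (posdef_sym pQ).
rewrite !mulmx_block !mul0mx !add0r !mul_scalar_mx.
rewrite -!scalemxAl (mulmxKV uQ) !scaleNr.
rewrite subrr !mul0mx !mulmx0 !addr0 !add0r.
rewrite LQL mulmxN -scalemxAr mulmxA (mulmxK uQ) !mul_mx_scalar subrr.
rewrite -scalerBr scalerA.
rewrite [X in block_mx X](_ : _ = 1%:M); first by rewrite -scalar_mx_block.
by apply/matrixP => i j; rewrite !ord1 mxE rr mxE eqxx.
Qed.

Lemma posdef_whitening d (S : 'M[R]_d) : posdef S ->
  exists2 L : 'M[R]_d, L \in unitmx & L *m S *m L^T = 1%:M.
Proof.
elim: d S => [|d IH] S pS.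
  by exists 1%:M; [exact: unitmx1|apply/matrixP => -[]].
have [L uL LQL] := IH _ (@posdef_drsubmx d S pS).
exact: posdef_whitening_step pS uL LQL.
Qed.

Lemma posdef_inv d (S : 'M[R]_d) : posdef S -> posdef (invmx S).
Proof.
move=> pS; have uS := posdef_unitmx pS; split.
  by rewrite trmx_inv (posdef_sym pS).
move=> v v0; have : v *m invmx S != 0.
  by apply: contra v0 => /eqP vS; rewrite -(mulmxKV uS v) vS mul0mx.
move=> /(posdef_qf_gt0 pS); rewrite /qf mulmxKV// trmx_mul trmx_inv.
by rewrite (posdef_sym pS) mulmxA.
Qed.

Lemma posdef_coercive d (S : 'M[R]_d) : posdef S ->
  exists2 e : R, 0 < e & forall v, e * sqn v <= qf S v.
Proof.
move=> pS; have [L uL LSL] := posdef_whitening pS.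
(* The [+ 1] keeps the witness positive in dimension 0 as well. *)
have F0 : 0 < frob L + 1 by rewrite ltr_wpDl ?frob_ge0.
exists (frob L + 1)^-1; rewrite ?invr_gt0// => v.
rewrite ler_pdivrMl//; set u := v *m invmx L.
have vE : v = u *m L by rewrite /u mulmxKV.
have -> : qf S v = sqn u.
  rewrite /qf {1 2}vE trmx_mul /sqn.
  have -> : u *m L *m S *m (L^T *m u^T) = u *m (L *m S *m L^T) *m u^T.
    by rewrite !mulmxA.
  by rewrite LSL mulmx1.
rewrite vE; apply: (le_trans (sqn_mulmx_le _ _)).
by rewrite mulrC ler_wpM2r ?sqn_ge0// lerDl.
Qed.

(* Concavity of the log-determinant, tangent line at S0. *)
Lemma ln_det_tangent d (S0 S : 'M[R]_d) : posdef S0 -> posdef S ->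
  ln (\det S) <= ln (\det S0) + \tr (invmx S0 *m S) - d%:R.
Proof.
move=> p0 pS; have [L uL L1] := posdef_whitening p0.
(* Whitening by [S0] moves the point of tangency to the identity, where the tangent inequality is
   the trace bound. *)
have := ln_det_le_trace (posdef_congr uL pS).
have d0 := posdef_det_gt0 p0; have dS := posdef_det_gt0 pS.
have uLT : L^T \in unitmx by rewrite unitmx_tr.
have LL : L^T *m L = invmx S0.
  have : S0 *m (L^T *m L) = 1%:M.
    have e : L *m (S0 *m (L^T *m L)) = L by rewrite !mulmxA L1 mul1mx.
    by rewrite -[LHS](mulKmx uL) e mulVmx.
  by move=> e; rewrite -[LHS](mulKmx (posdef_unitmx p0)) e mulmx1.
have -> : \tr (L *m S *m L^T) = \tr (invmx S0 *m S).
  by rewrite mxtrace_mulC mulmxA LL.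
have -> : \det (L *m S *m L^T) = \det S / \det S0.
  rewrite !det_mulmx mulrAC -det_mulmx mulrC; congr (_ * _).
  by rewrite det_mulmx mulrC -det_mulmx LL det_inv.
by rewrite ln_div ?posrE//; lra.
Qed.

End quadratic_forms.

(** * Iterated Lebesgue integrals over row vectors *)

Section iterated_integral.
Variable R : realType.
Local Notation leb := (@lebesgue_measure R).

(* No measurability is needed: the integral of a nonnegative function is a
   supremum over the simple functions below it. *)
Lemma le_integral_any (f g : R -> \bar R) : (forall x, f x <= g x)%E ->
  (\int[leb]_x f x <= \int[leb]_x g x)%E.
Proof.
move=> fg; have mono (p q : R -> \bar R) : (forall x, 0 <= p x)%E ->
    (forall x, p x <= q x)%E -> (\int[leb]_x p x <= \int[leb]_x q x)%E.
  move=> p0 pq; have q0 x : (0 <= q x)%E by exact: le_trans (p0 x) (pq x).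
  rewrite !ge0_integralTE//; apply: le_ereal_sup => _ /= [h hp <-].
  by exists h => // x; exact: le_trans (hp x) (pq x).
rewrite [leLHS]integralE [leRHS]integralE; apply: leeB.
- apply: mono => x; first by rewrite funeposE le_max lexx orbT.
  rewrite !funeposE ge_max; apply/andP; split; rewrite le_max ?lexx ?orbT//.
  by rewrite fg.
- apply: mono => x; first by rewrite funenegE le_max lexx orbT.
  rewrite !funenegE ge_max; apply/andP; split; rewrite le_max ?lexx ?orbT//.
  by rewrite leeN2 fg.
Qed.

Lemma le_intRn m (f g : 'rV[R]_m -> \bar R) : (forall v, f v <= g v)%E ->
  (intRn f <= intRn g)%E.
Proof.
elim: m f g => [|m IH] f g fg /=; first exact: fg.
by apply: le_integral_any => x; apply: IH => v; exact: fg.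
Qed.

Lemma eq_intRn m (f g : 'rV[R]_m -> \bar R) : f =1 g -> intRn f = intRn g.
Proof. by move=> /funext ->. Qed.

Lemma intRn_ge0 m (f : 'rV[R]_m -> \bar R) : (forall v, 0 <= f v)%E ->
  (0 <= intRn f)%E.
Proof.
elim: m f => [|m IH] f f0 /=; first exact: f0.
by apply: integral_ge0 => x _; exact: IH.
Qed.

Definition mxmeas d (Z : measurableType d) p q (A : Z -> 'M[R]_(p, q)) :=
  forall i j, measurable_fun setT (fun z => A z i j).

(* Joint measurability, phrased by composition with measurable maps so that no
   sigma-algebra on row vectors is needed. *)
Definition jmeas d (Z : measurableType d) m (F : Z -> 'rV[R]_m -> \bar R) :=
  forall d' (Z' : measurableType d') (h : Z' -> Z) (g : Z' -> 'rV[R]_m),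
    measurable_fun setT h -> mxmeas g ->
    measurable_fun setT (fun z => F (h z) (g z)).

Definition vmeas m (f : 'rV[R]_m -> \bar R) :=
  forall d (Z : measurableType d) (g : Z -> 'rV[R]_m),
    mxmeas g -> measurable_fun setT (fun z => f (g z)).

Definition vmeas2 m k (F : 'rV[R]_m -> 'rV[R]_k -> \bar R) :=
  forall d (Z : measurableType d) (g : Z -> 'rV[R]_m) (h : Z -> 'rV[R]_k),
    mxmeas g -> mxmeas h -> measurable_fun setT (fun z => F (g z) (h z)).

Lemma mxmeas_cst d (Z : measurableType d) p q (A : 'M[R]_(p, q)) :
  mxmeas (fun _ : Z => A).
Proof. by move=> i j; exact: measurable_cst. Qed.

Lemma mxmeas_row_mx d (Z : measurableType d) m k r
    (g : Z -> 'M[R]_(r, m)) (h : Z -> 'M[R]_(r, k)) :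
  mxmeas g -> mxmeas h -> mxmeas (fun z => row_mx (g z) (h z)).
Proof.
move=> mg mh i j; under eq_fun do rewrite mxE.
by case: (fintype.split j) => k'; [exact: mg|exact: mh].
Qed.

Lemma mxmeas_row1 d (Z : measurableType d) (g : Z -> R) :
  measurable_fun setT g -> mxmeas (fun z => \row_(j < 1) g z).
Proof. by move=> mg i j; under eq_fun do rewrite mxE. Qed.

(** The first coordinate moves from the row vector into the parameter space; this is the induction
    step for measurability of iterated integrals. *)
Lemma jmeas_cons d (Z : measurableType d) m (F : Z -> 'rV[R]_m.+1 -> \bar R) :
  jmeas F ->
  jmeas (fun (y : Z * measurableTypeR R) (v : 'rV[R]_m) =>
    F y.1 (row_mx (\row_(j < 1) y.2) v)).
Proof.
move=> mF d' Z' h g mh mg; apply: mF.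
  exact: (measurableT_comp measurable_fst mh).
apply: (@mxmeas_row_mx _ _ 1) => //; apply: mxmeas_row1.
exact: (measurableT_comp measurable_snd mh).
Qed.

(** Tonelli's theorem concerns nonnegative integrands, hence the split into positive and negative
    parts. *)
Lemma measurable_integral_snd d (Z : measurableType d)
    (f : Z * measurableTypeR R -> \bar R) : measurable_fun setT f ->
  measurable_fun setT (fun z => \int[leb]_x f (z, x))%E.
Proof.
move=> mf; under eq_fun do rewrite integralE.
apply: emeasurable_funB.
- have h : measurable_fun setT (fubini_F leb f^\+%E).
    apply: measurable_fun_fubini_tonelli_F; first exact: measurable_funepos.
    by move=> z; rewrite funeposE le_max lexx orbT.
  apply: eq_measurable_fun h => z _; apply: eq_integral => x _.
  by rewrite !funeposE.
- have h : measurable_fun setT (fubini_F leb f^\-%E).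
    apply: measurable_fun_fubini_tonelli_F; first exact: measurable_funeneg.
    by move=> z; rewrite funenegE le_max lexx orbT.
  apply: eq_measurable_fun h => z _; apply: eq_integral => x _.
  by rewrite !funenegE.
Qed.

Lemma measurable_intRn d (Z : measurableType d) m (F : Z -> 'rV[R]_m -> \bar R) :
  jmeas F -> measurable_fun setT (fun z => intRn (F z)).
Proof.
elim: m d Z F => [|m IH] d Z F mF /=.
  by apply: mF => //; exact: mxmeas_cst.
apply: (@measurable_integral_snd _ _ (fun y : Z * measurableTypeR R =>
  intRn (fun v : 'rV[R]_m => F y.1 (row_mx (\row_(j < 1) y.2) v)))).
by apply: IH; exact: jmeas_cons.
Qed.

Lemma jmeas_intRn d (Z : measurableType d) m k
    (F : Z -> 'rV[R]_m -> 'rV[R]_k -> \bar R) :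
  (forall d' (Z' : measurableType d') (h : Z' -> Z) (g : Z' -> 'rV[R]_m)
     (g' : Z' -> 'rV[R]_k), measurable_fun setT h -> mxmeas g -> mxmeas g' ->
     measurable_fun setT (fun z => F (h z) (g z) (g' z))) ->
  jmeas (fun z v => intRn (F z v)).
Proof.
move=> mF d' Z' h g mh mg; apply: (@measurable_intRn _ _ _ (fun z => F (h z) (g z))).
move=> d2 Z2 h2 g2 mh2 mg2; apply: (mF d2 Z2 (h \o h2) (g \o h2)) => //.
- exact: measurableT_comp.
- by move=> i j; exact: (measurableT_comp (mg i j) mh2).
Qed.

Lemma vmeas_cons m (f : 'rV[R]_m.+1 -> \bar R) (x : R) : vmeas f ->
  vmeas (fun v : 'rV[R]_m => f (row_mx (\row_(j < 1) x) v)).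
Proof.
move=> mf d Z g mg; apply: (mf d Z (fun z => row_mx (\row_(j < 1) x) (g z))).
by apply: (@mxmeas_row_mx _ _ 1) => //; exact: mxmeas_cst.
Qed.

Lemma jmeas_vmeas m (f : 'rV[R]_m.+1 -> \bar R) : vmeas f ->
  jmeas (fun (x : measurableTypeR R) (v : 'rV[R]_m) =>
    f (row_mx (\row_(j < 1) x) v)).
Proof.
move=> mf d Z h g mh mg.
apply: (mf d Z (fun z => row_mx (\row_(j < 1) h z) (g z))).
by apply: (@mxmeas_row_mx _ _ 1) => //; exact: mxmeas_row1.
Qed.

Lemma measurable_section m (f : 'rV[R]_m.+1 -> \bar R) : vmeas f ->
  measurable_fun setT (fun x : measurableTypeR R =>
    intRn (fun v : 'rV[R]_m => f (row_mx (\row_(j < 1) x) v))).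
Proof. by move=> /jmeas_vmeas /measurable_intRn. Qed.

Lemma ge0_intRnD m (f g : 'rV[R]_m -> \bar R) : vmeas f -> vmeas g ->
  (forall v, 0 <= f v)%E -> (forall v, 0 <= g v)%E ->
  intRn (fun v => f v + g v)%E = (intRn f + intRn g)%E.
Proof.
elim: m f g => [|m IH] f g mf mg f0 g0 //=.
under eq_integral => x _.
  rewrite (IH (fun v => f (row_mx (\row_(j < 1) x) v))
              (fun v => g (row_mx (\row_(j < 1) x) v))) //; first over.
  - exact: vmeas_cons.
  - exact: vmeas_cons.
rewrite ge0_integralD//=.
- by move=> x _; exact: intRn_ge0.
- exact: measurable_section.
- by move=> x _; exact: intRn_ge0.
- exact: measurable_section.
Qed.

Lemma ge0_intRnZ m (c : R) (f : 'rV[R]_m -> \bar R) : vmeas f ->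
  (forall v, 0 <= f v)%E -> 0 <= c ->
  intRn (fun v => c%:E * f v)%E = (c%:E * intRn f)%E.
Proof.
move=> mf f0 c0; elim: m f mf f0 => [|m IH] f mf f0 //=.
under eq_integral => x _.
  rewrite (IH (fun v => f (row_mx (\row_(j < 1) x) v))) //; first over.
  exact: vmeas_cons.
rewrite ge0_integralZl_EFin//=.
- by move=> x _; exact: intRn_ge0.
- exact: measurable_section.
Qed.

Lemma vmeas_sum m (I : Type) (s : seq I) (f : I -> 'rV[R]_m -> \bar R) :
  (forall i, vmeas (f i)) -> vmeas (fun v => \sum_(i <- s) f i v)%E.
Proof. by move=> mf d Z h mh; apply: emeasurable_sum => i; exact: mf. Qed.

Lemma intRn_cst0 m : intRn (fun _ : 'rV[R]_m => 0%E) = 0%E.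
Proof. by elim: m => [//|m IH] /=; rewrite IH integral0. Qed.

Lemma ge0_intRn_sum m (I : Type) (s : seq I) (f : I -> 'rV[R]_m -> \bar R) :
  (forall i, vmeas (f i)) -> (forall i v, 0 <= f i v)%E ->
  intRn (fun v => \sum_(i <- s) f i v)%E = (\sum_(i <- s) intRn (f i))%E.
Proof.
move=> mf f0; elim: s => [|i s IH].
  by under eq_intRn do rewrite big_nil; rewrite intRn_cst0 big_nil.
under eq_intRn do rewrite big_cons.
rewrite ge0_intRnD ?IH ?big_cons//; first exact: vmeas_sum.
by move=> v; apply: sume_ge0.
Qed.

(** The outer variable moves inwards past one coordinate at a time, each time by Tonelli's theorem
    on the plane. *)
Lemma integral_intRn_swap m (F : measurableTypeR R -> 'rV[R]_m -> \bar R) :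
  jmeas F -> (forall x v, 0 <= F x v)%E ->
  (\int[leb]_x intRn (F x) = intRn (fun v => \int[leb]_x F x v))%E.
Proof.
elim: m F => [|m IH] F mF F0 //=.
pose G (y : measurableTypeR R * measurableTypeR R) :=
  intRn (fun v : 'rV[R]_m => F y.1 (row_mx (\row_(j < 1) y.2) v)).
have mG : measurable_fun setT G by apply: measurable_intRn; exact: jmeas_cons.
have G0 y : (0 <= G y)%E by exact: intRn_ge0.
transitivity (\int[leb]_y \int[leb]_x G (x, y))%E.
  exact: (@fubini_tonelli _ _ _ _ _ leb leb G mG G0).
apply: eq_integral => y _; apply: IH => // d Z h g mh mg.
apply: mF => //; apply: (@mxmeas_row_mx _ _ 1) => //; exact: (mxmeas_cst (\row_(j < 1) y)).
Qed.

Lemma intRn_swap m k (F : 'rV[R]_m -> 'rV[R]_k -> \bar R) :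
  vmeas2 F -> (forall u v, 0 <= F u v)%E ->
  intRn (fun u => intRn (F u)) = intRn (fun v => intRn (F ^~ v)).
Proof.
elim: m F => [|m IH] F mF F0 //=.
rewrite -(@integral_intRn_swap _ (fun x v =>
  intRn (fun u : 'rV[R]_m => F (row_mx (\row_(j < 1) x) u) v))).
- apply: eq_integral => x _; apply: IH => // d Z g h mg mh; apply: mF => //.
  by apply: (@mxmeas_row_mx _ _ 1) => //; exact: mxmeas_cst.
- apply: jmeas_intRn => d Z h g g' mh mg mg'; apply: mF => //.
  by apply: (@mxmeas_row_mx _ _ 1) => //; exact: mxmeas_row1.
- by move=> x v; exact: intRn_ge0.
Qed.

Lemma intRn_cat m1 m2 (f : 'rV[R]_(m1 + m2) -> \bar R) :
  intRn f = intRn (fun u : 'rV[R]_m1 => intRn (fun v : 'rV[R]_m2 => f (row_mx u v))).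
Proof.
elim: m1 f => [|m1 IH] f /=.
  apply: eq_intRn => v; congr f.
  by apply/rowP => i; rewrite mxE; case: splitP => [[]//|k ik]; congr (v _ _); exact: val_inj.
apply: eq_integral => x _; rewrite IH; apply: eq_intRn => u; apply: eq_intRn => v.
congr f; have /= := @row_mxA _ _ _ _ _ (\row_(j < 1) x) u v.
by rewrite castmx_id.
Qed.


Lemma sqn_row_mx m (x : R) (v : 'rV[R]_m) :
  sqn (row_mx (\row_(j < 1) x) v) = x ^+ 2 + sqn v.
Proof.
rewrite /sqn tr_row_mx mul_row_col mxE; congr (_ + _).
by rewrite mxE big_ord1 !mxE expr2.
Qed.

Lemma integral_expR_sqr (e : R) : 0 < e ->
  exists2 c : R, 0 < c & (\int[leb]_x (expR (- e * x ^+ 2))%:E = c%:E)%E.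
Proof.
(* The standard deviation with 1 / (2 s^2) = e, so that the integrand is a multiple of a normal
   density. *)
move=> e0; set s := (Num.sqrt (2 * e))^-1.
have e20 : 0 < 2 * e by rewrite mulr_gt0.
have s0 : s != 0 by rewrite invr_eq0 gt_eqF// sqrtr_gt0.
exists (normal_peak s)^-1; first by rewrite invr_gt0 normal_peak_gt0.
have pk := normal_peak_gt0 s0.
transitivity (\int[leb]_x ((normal_peak s)^-1%:E * (normal_pdf 0 s x)%:E))%E.
  apply: eq_integral => x _; rewrite -EFinM normal_pdfE// mulKf ?gt_eqF//.
  congr (_%:E); congr expR; rewrite subr0 /s exprVn sqr_sqrtr ?(ltW e20)//.
  by field; rewrite gt_eqF.
rewrite integralZl//=; last exact: integrable_normal_pdf.
by rewrite integral_normal_pdf mule1.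
Qed.

Lemma integrable_expR_sqr (e C : R) : 0 < e ->
  leb.-integrable setT (fun x => (C * expR (- e * x ^+ 2))%:E).
Proof.
move=> e0; have [c c0 ec] := integral_expR_sqr e0.
have mE : measurable_fun setT (fun x : measurableTypeR R => expR (- e * x ^+ 2)).
  apply: measurableT_comp => //; apply: measurable_funM => //.
have : leb.-integrable setT (fun x : R => (expR (- e * x ^+ 2))%:E).
  apply/integrableP; split; first exact/measurable_EFinP.
  under eq_integral do rewrite /= ger0_norm ?expR_ge0//.
  by rewrite ec ltry.
by move=> /(integrableZl measurableT C); apply: eq_integrable => // x _; rewrite EFinM.
Qed.

(** [c] is the one-dimensional integral; quantifying over [C] after it lets [C] absorb the factor of
    each coordinate that is peeled off. *)
Lemma intRn_expR_sqn (e : R) : 0 < e ->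
  exists2 c : R, 0 < c & forall m C,
    intRn (fun v : 'rV[R]_m => (C * expR (- e * sqn v))%:E) = (C * c ^+ m)%:E.
Proof.
move=> e0; have [c c0 ec] := integral_expR_sqr e0; exists c => //.
elim=> [|m IH] C /=; first by rewrite sqn0 mulr0 expR0 !mulr1.
under eq_integral => x _.
  rewrite [X in intRn X](_ : _ =
    fun v => ((C * expR (- e * x ^+ 2)) * expR (- e * sqn v))%:E); last first.
    by apply/funext => v; rewrite sqn_row_mx mulrDr expRD mulrA.
  rewrite IH mulrAC EFinM; over.
rewrite integralZl//=; last first.
  have := integrable_expR_sqr 1 e0.
  by apply: eq_integrable => // x _; rewrite mul1r.
by rewrite ec -EFinM exprSr mulrA.
Qed.

(* Domination by an isotropic Gaussian passes to sections, so every inner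
   integral of the iterated integral is finite. *)
Definition gdom m (f : 'rV[R]_m -> R) :=
  vmeas (fun v => (f v)%:E) /\
  exists C e : R, 0 < e /\ forall v, `|f v| <= C * expR (- e * sqn v).

Lemma gdom_intRn m (f : 'rV[R]_m -> R) : gdom f ->
  intRn (fun v => (f v)%:E) \is a fin_num.
Proof.
move=> [_ [C [e [e0 fC]]]]; have [c c0 ec] := intRn_expR_sqn e0.
rewrite fin_numElt; apply/andP; split.
- apply: (@lt_le_trans _ _ (intRn (fun v : 'rV[R]_m => (- C * expR (- e * sqn v))%:E))).
    by rewrite ec ltNyr.
  apply: le_intRn => v; rewrite lee_fin mulNr; have := fC v.
  by rewrite ler_norml => /andP[].
- apply: (@le_lt_trans _ _ (intRn (fun v : 'rV[R]_m => (C * expR (- e * sqn v))%:E))).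
    apply: le_intRn => v; rewrite lee_fin; have := fC v.
    by rewrite ler_norml => /andP[].
  by rewrite ec ltry.
Qed.

Lemma gdom_cons m (f : 'rV[R]_m.+1 -> R) (x : R) : gdom f ->
  gdom (fun v : 'rV[R]_m => f (row_mx (\row_(j < 1) x) v)).
Proof.
move=> [mf [C [e [e0 fC]]]]; split.
  exact: (@vmeas_cons _ (fun v => (f v)%:E)).
exists (C * expR (- e * x ^+ 2)), e; split => // v.
by have := fC (row_mx (\row_(j < 1) x) v); rewrite sqn_row_mx mulrDr expRD mulrA.
Qed.

Lemma gdom_integrable m (f : 'rV[R]_m.+1 -> R) : gdom f ->
  leb.-integrable setT
    (fun x => intRn (fun v : 'rV[R]_m => (f (row_mx (\row_(j < 1) x) v))%:E)).
Proof.
move=> gf; have [mf [C [e [e0 fC]]]] := gf.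
have [c c0 ec] := intRn_expR_sqn e0.
apply: (le_integrable measurableT _ _ (integrable_expR_sqr (C * c ^+ m) e0)).
- exact: (@measurable_section _ (fun v => (f v)%:E)).
- move=> x _; have fin := gdom_intRn (gdom_cons x gf).
  rewrite -(fineK fin) /= lee_fin ler_norml; apply/andP; split.
  + rewrite -lee_fin fineK//.
    apply: (@le_trans _ _ (intRn (fun v : 'rV[R]_m =>
      (- (C * expR (- e * x ^+ 2)) * expR (- e * sqn v))%:E))).
      rewrite ec lee_fin (mulNr (C * _)) lerN2; apply: le_trans (ler_norm _).
      by rewrite mulrAC.
    apply: le_intRn => v; rewrite lee_fin.
    have := fC (row_mx (\row_(j < 1) x) v); rewrite sqn_row_mx mulrDr expRD mulrA.
    by rewrite ler_norml (mulNr (C * _)) => /andP[].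
  + rewrite -lee_fin fineK//.
    apply: (@le_trans _ _ (intRn (fun v : 'rV[R]_m =>
      ((C * expR (- e * x ^+ 2)) * expR (- e * sqn v))%:E))).
      apply: le_intRn => v; rewrite lee_fin.
      have := fC (row_mx (\row_(j < 1) x) v); rewrite sqn_row_mx mulrDr expRD mulrA.
      by rewrite ler_norml => /andP[].
    rewrite ec lee_fin; apply: le_trans (ler_norm _).
    by rewrite mulrAC.
Qed.

Lemma gdom_intRn_lin m (a b : R) (f g : 'rV[R]_m -> R) : gdom f -> gdom g ->
  intRn (fun v => (a * f v + b * g v)%:E) =
  (a%:E * intRn (fun v => (f v)%:E) + b%:E * intRn (fun v => (g v)%:E))%E.
Proof.
elim: m f g => [|m IH] f g gf gg; first by rewrite /= -!EFinM -EFinD.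
rewrite /=; under eq_integral => x _.
  rewrite (IH (fun v => f (row_mx (\row_(j < 1) x) v))
              (fun v => g (row_mx (\row_(j < 1) x) v))); first over.
  - exact: gdom_cons.
  - exact: gdom_cons.
have If := gdom_integrable gf; have Ig := gdom_integrable gg.
rewrite integralD//=; try exact: integrableZl.
by rewrite integralZl// integralZl.
Qed.

(** Serves to integrate a signed function plus an evidence whose integral may be infinite. In that
    case the right-hand side is infinite too, because the integral of [f] is finite. *)
Lemma intRn_le_gdomD m (f : 'rV[R]_m -> R) (h : 'rV[R]_m -> \bar R) :
  gdom f -> vmeas h -> (forall v, 0 <= h v)%E ->
  (intRn (fun v => (f v)%:E + h v) <= intRn (fun v => (f v)%:E) + intRn h)%E.
Proof.
elim: m f h => [|m IH] f h gf mh h0 //=.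
have If := gdom_integrable gf.
have mH := measurable_section mh.
have H0 x : (0 <= intRn (fun v : 'rV[R]_m => h (row_mx (\row_(j < 1) x) v)))%E.
  exact: intRn_ge0.
set F := fun x => intRn (fun v : 'rV[R]_m => (f (row_mx (\row_(j < 1) x) v))%:E).
set H := fun x => intRn (fun v : 'rV[R]_m => h (row_mx (\row_(j < 1) x) v)).
apply: (@le_trans _ _ (\int[leb]_x (F x + H x))%E).
  apply: le_integral_any => x.
  apply: (IH (fun v => f (row_mx (\row_(j < 1) x) v))) => //; first exact: gdom_cons.
  exact: vmeas_cons.
have [Hoo|Hfin] := eqVneq (\int[leb]_x H x)%E +oo%E.
  rewrite -[X in (_ <= _ + X)%E]/(\int[leb]_x H x)%E Hoo addey ?leey//.
  by have := integrable_fin_num measurableT If; rewrite fin_numE => /andP[].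
rewrite integralD//; apply/integrableP; split; first exact: mH.
under eq_integral => x _ do rewrite gee0_abs ?[X in (0 <= X)%E](_ : _ = H x) ?H0//.
by rewrite ltey.
Qed.

End iterated_integral.

(** * Integrals over matrices, by rows and by columns *)

Section matrix_integral.
Variable R : realType.
Local Notation leb := (@lebesgue_measure R).

Lemma nth_allpairs_pair (S T : Type) (x0 : S) (y0 : T) (s : seq S) (t : seq T) i j :
  (i < size s)%N -> (j < size t)%N ->
  nth (x0, y0) [seq (x, y) | x <- s, y <- t] (i * size t + j) =
  (nth x0 s i, nth y0 t j).
Proof.
elim: s i => [//|x s IH] [|i] /= si tj.
  by rewrite nth_cat size_map mul0n add0n tj (nth_map y0).
rewrite nth_cat size_map mulSn -addnA ltnNge leq_addr/= addnC addnK.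
exact: IH.
Qed.

(** [mxvec_index] is a rank in the enumeration of pairs. Its value shows that vectorisation is
    row-major, so that the first row occupies the first coordinates of the iterated integral. *)
Lemma mxvec_index_val m n (i : 'I_m) (j : 'I_n) :
  mxvec_index i j = (i * n + j)%N :> nat.
Proof.
rewrite /mxvec_index /=.
have eE : enum {: 'I_m * 'I_n} = [seq (x, y) | x <- enum 'I_m, y <- enum 'I_n].
  by rewrite enumT unlock.
have sz : (i * n + j < size (enum {: 'I_m * 'I_n}))%N.
  rewrite -cardE card_prod !card_ord.
  apply: (@leq_trans (i * n + n)); first by rewrite ltn_add2l.
  by rewrite -mulSnr leq_mul2r ltn_ord orbT.
have := @nth_allpairs_pair _ _ i j (enum 'I_m) (enum 'I_n) i j.
rewrite -eE !size_enum_ord !nth_ord_enum => /(_ (ltn_ord i) (ltn_ord j)) nE.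
apply/eqP; rewrite -(nth_uniq (i, j) _ sz (enum_uniq _)) ?nE ?nth_enum_rank//.
by rewrite -cardE ltn_ord.
Qed.

Lemma vec_mx_row_mx n d (u : 'rV[R]_d) (v : 'rV[R]_(n * d)) :
  (vec_mx (row_mx u v : 'rV[R]_(n.+1 * d)) : 'M[R]_(n.+1, d)) = col_mx u (vec_mx v).
Proof.
apply/matrixP => i j; rewrite [LHS]mxE.
have [k ->|k ->] := @split_ordP 1 n i.
- rewrite [RHS](@col_mxEu _ 1 n).
  have -> : mxvec_index (lshift n k : 'I_n.+1) j = lshift (n * d) j.
    apply: val_inj; rewrite [LHS](mxvec_index_val (lshift n k : 'I_n.+1) j).
    by rewrite /= ord1 mul0n.
  by rewrite row_mxEl (ord1 k).
- rewrite [RHS](@col_mxEd _ 1 n) [RHS]mxE.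
  have -> : mxvec_index (rshift 1 k : 'I_n.+1) j = rshift d (mxvec_index k j).
    apply: val_inj; rewrite [LHS](mxvec_index_val (rshift 1 k : 'I_n.+1) j).
    transitivity (d + mxvec_index k j)%N => //.
    by rewrite mxvec_index_val/= mulSn addnA.
  by rewrite row_mxEr.
Qed.

Lemma intM_row n d (f : 'M[R]_(n.+1, d) -> \bar R) :
  intM f = intRn (fun u : 'rV[R]_d => intM (fun X : 'M[R]_(n, d) => f (col_mx u X))).
Proof.
rewrite /intM (@intRn_cat R d (n * d)).
by apply: eq_intRn => u; apply: eq_intRn => v; rewrite vec_mx_row_mx.
Qed.

Lemma intRn_dim0 m (f : 'rV[R]_m -> \bar R) : m = 0%N -> intRn f = f 0.
Proof. by move=> m0; subst m. Qed.

Definition mmeas p q (f : 'M[R]_(p, q) -> \bar R) :=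
  forall d (Z : measurableType d) (g : Z -> 'M[R]_(p, q)),
    mxmeas g -> measurable_fun setT (fun z => f (g z)).

Definition mmeas2 p q r s (F : 'M[R]_(p, q) -> 'M[R]_(r, s) -> \bar R) :=
  forall d (Z : measurableType d) (g : Z -> 'M[R]_(p, q)) (h : Z -> 'M[R]_(r, s)),
    mxmeas g -> mxmeas h -> measurable_fun setT (fun z => F (g z) (h z)).

Section mxmeas_theory.
Context d (Z : measurableType d).

Lemma mxmeas_vec_mx p q (g : Z -> 'rV[R]_(p * q)) : mxmeas g ->
  mxmeas (fun z => vec_mx (g z)).
Proof. by move=> mg i j; under eq_fun do rewrite mxE; exact: mg. Qed.

Lemma mxmeas_col_mx p q r (g : Z -> 'M[R]_(p, r)) (h : Z -> 'M[R]_(q, r)) :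
  mxmeas g -> mxmeas h -> mxmeas (fun z => col_mx (g z) (h z)).
Proof.
move=> mg mh i j; under eq_fun do rewrite mxE.
by case: (fintype.split i) => k'; [exact: mg|exact: mh].
Qed.

Lemma mxmeas_tr p q (g : Z -> 'M[R]_(p, q)) : mxmeas g -> mxmeas (fun z => (g z)^T).
Proof. by move=> mg i j; under eq_fun do rewrite mxE; exact: mg. Qed.

Lemma mxmeasD p q (g h : Z -> 'M[R]_(p, q)) : mxmeas g -> mxmeas h ->
  mxmeas (fun z => g z + h z).
Proof.
move=> mg mh i j; under eq_fun do rewrite mxE.
by apply: measurable_funD; [exact: mg|exact: mh].
Qed.

Lemma mxmeasN p q (g : Z -> 'M[R]_(p, q)) : mxmeas g -> mxmeas (fun z => - g z).
Proof.
move=> mg i j; under eq_fun do rewrite mxE.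
exact: (measurableT_comp _ (mg i j)).
Qed.

Lemma mxmeasM p q r (g : Z -> 'M[R]_(p, q)) (h : Z -> 'M[R]_(q, r)) :
  mxmeas g -> mxmeas h -> mxmeas (fun z => g z *m h z).
Proof.
move=> mg mh i j; under eq_fun do rewrite mxE.
apply: measurable_sum => k.
by apply: measurable_funM; [exact: mg|exact: mh].
Qed.

Lemma mxmeas_row p q (g : Z -> 'M[R]_(p, q)) i : mxmeas g ->
  mxmeas (fun z => row i (g z)).
Proof. by move=> mg k j; under eq_fun do rewrite mxE; exact: mg. Qed.

Lemma mxmeas_col p q (g : Z -> 'M[R]_(p, q)) j : mxmeas g ->
  mxmeas (fun z => col j (g z)).
Proof. by move=> mg k l; under eq_fun do rewrite mxE; exact: mg. Qed.

Lemma measurable_det p (g : Z -> 'M[R]_p) : mxmeas g ->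
  measurable_fun setT (fun z => \det (g z)).
Proof.
move=> mg; rewrite /determinant; apply: measurable_sum => s.
apply: measurable_funM; first exact: measurable_cst.
by apply: measurable_prod => i _; exact: mg.
Qed.

Lemma mxmeas_inv p (g : Z -> 'M[R]_p) : (forall z, posdef (g z)) -> mxmeas g ->
  mxmeas (fun z => invmx (g z)).
Proof.
move=> pg mg i j.
(* Positivity of the determinant lets its inverse be written as an exponential, so measurability
   follows from that of [expR] and [ln]. *)
rewrite (_ : (fun z => _) = (fun z => expR (- ln (\det (g z))) * cofactor (g z) j i)).
  apply: measurable_funM.
    apply: measurableT_comp => //; apply: measurableT_comp => //.
    by apply: measurableT_comp; [exact: measurable_ln|exact: measurable_det].
  rewrite /cofactor; apply: measurable_funM; first exact: measurable_cst.
  apply: measurable_det => k l; under eq_fun do rewrite !mxE.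
  exact: mg.
apply/funext => z; rewrite /invmx (posdef_unitmx (pg z)) !mxE expRN lnK//.
exact: posdef_det_gt0.
Qed.

Lemma measurable_qf p (A : Z -> 'M[R]_p) (v : Z -> 'rV[R]_p) :
  mxmeas A -> mxmeas v -> measurable_fun setT (fun z => qf (A z) (v z)).
Proof.
move=> mA mv; rewrite /qf.
have := mxmeasM (mxmeasM mv mA) (mxmeas_tr mv); exact.
Qed.

End mxmeas_theory.

Lemma eq_intM p q (f g : 'M[R]_(p, q) -> \bar R) : f =1 g -> intM f = intM g.
Proof. by move=> /funext ->. Qed.

Lemma le_intM p q (f g : 'M[R]_(p, q) -> \bar R) : (forall A, f A <= g A)%E ->
  (intM f <= intM g)%E.
Proof. by move=> fg; apply: le_intRn => v; exact: fg. Qed.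

Lemma intM_ge0 p q (f : 'M[R]_(p, q) -> \bar R) : (forall A, 0 <= f A)%E ->
  (0 <= intM f)%E.
Proof. by move=> f0; apply: intRn_ge0 => v; exact: f0. Qed.

Lemma mmeas_vmeas p q (f : 'M[R]_(p, q) -> \bar R) : mmeas f ->
  vmeas (fun v => f (vec_mx v)).
Proof. by move=> mf d Z g mg; apply: mf; exact: mxmeas_vec_mx. Qed.

Lemma measurable_intM d (Z : measurableType d) r s p q
    (g : Z -> 'M[R]_(r, s)) (F : 'M[R]_(r, s) -> 'M[R]_(p, q) -> \bar R) :
  mmeas2 F -> mxmeas g -> measurable_fun setT (fun z => intM (F (g z))).
Proof.
move=> mF mg; apply: (@measurable_intRn _ _ _ _ (fun z v => F (g z) (vec_mx v))).
move=> d' Z' h' g' mh' mg'; apply: (mF d' Z' (g \o h')).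
  by move=> i j; exact: (measurableT_comp (mg i j) mh').
exact: mxmeas_vec_mx.
Qed.

Lemma ge0_intMD p q (f g : 'M[R]_(p, q) -> \bar R) : mmeas f -> mmeas g ->
  (forall v, 0 <= f v)%E -> (forall v, 0 <= g v)%E ->
  intM (fun v => f v + g v)%E = (intM f + intM g)%E.
Proof.
move=> mf mg f0 g0.
exact: (@ge0_intRnD _ _ (fun v => f (vec_mx v)) (fun v => g (vec_mx v))
  (mmeas_vmeas mf) (mmeas_vmeas mg)).
Qed.

Lemma ge0_intMZ p q (c : R) (f : 'M[R]_(p, q) -> \bar R) : mmeas f ->
  (forall v, 0 <= f v)%E -> 0 <= c ->
  intM (fun v => c%:E * f v)%E = (c%:E * intM f)%E.
Proof.
by move=> mf f0 c0; apply: (@ge0_intRnZ _ _ _ (fun v => f (vec_mx v))) => //;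
  exact: mmeas_vmeas.
Qed.

Lemma ge0_intM_sum p q (I : Type) (s : seq I) (f : I -> 'M[R]_(p, q) -> \bar R) :
  (forall i, mmeas (f i)) -> (forall i v, 0 <= f i v)%E ->
  intM (fun v => \sum_(i <- s) f i v)%E = (\sum_(i <- s) intM (f i))%E.
Proof.
move=> mf f0; apply: (@ge0_intRn_sum _ _ _ _ (fun i v => f i (vec_mx v))) => //.
by move=> i; exact: mmeas_vmeas.
Qed.

Lemma intM_swap p q r s (F : 'M[R]_(p, q) -> 'M[R]_(r, s) -> \bar R) :
  mmeas2 F -> (forall A B, 0 <= F A B)%E ->
  intM (fun A => intM (F A)) = intM (fun B => intM (F ^~ B)).
Proof.
move=> mF F0; apply: (@intRn_swap _ _ _ (fun u v => F (vec_mx u) (vec_mx v))) => //.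
by move=> d Z g h mg mh; apply: mF; exact: mxmeas_vec_mx.
Qed.

Lemma intM_col p q (f : 'M[R]_(p, q.+1) -> \bar R) : mmeas f ->
  (forall A, 0 <= f A)%E ->
  intM f = intRn (fun u : 'rV[R]_p => intM (fun B : 'M[R]_(p, q) => f (row_mx u^T B))).
Proof.
elim: p f => [|p IH] f mf f0.
  by rewrite /intM !intRn_dim0//; congr f; apply/matrixP => -[].
rewrite intM_row /=; apply: eq_integral => x _.
(* The corner entry [x], the rest [r] of the first row and the rest [u] of the first column are
   separated; exchanging [r] and [u] brings the whole first column outside. *)
transitivity (intRn (fun r : 'rV[R]_q => intRn (fun u : 'rV[R]_p =>
    intM (fun B : 'M[R]_(p, q) =>
      f (block_mx (\row_(j < 1) x) r u^T B : 'M[R]_(1 + p, 1 + q)))))).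
  apply: eq_intRn => r; rewrite IH//.
  move=> d Z g mg; apply: mf; apply: (@mxmeas_col_mx _ _ 1) => //; exact: mxmeas_cst.
rewrite (@intRn_swap _ q p).
- apply: eq_intRn => u; rewrite intM_row; apply: eq_intRn => r.
  apply: eq_intM => B; congr f.
  rewrite block_mxEh (@tr_row_mx _ _ 1 p).
  rewrite [(\row_(j < 1) x)^T](_ : _ = \row_(j < 1) x)//.
  by apply/matrixP => i j; rewrite !mxE.
- move=> d Z g h mg mh.
  (* The two parameters are packed into one row, the form in which [measurable_intM] takes its
     parameter. *)
  pose F (w : 'M[R]_(1, p + q)) (B : 'M[R]_(p, q)) :=
    f (block_mx (\row_(j < 1) x) (rsubmx w) (lsubmx w)^T B : 'M[R]_(1 + p, 1 + q)).
  rewrite (_ : (fun z => _) = (fun z => intM (F (row_mx (h z) (g z))))); last first.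
    by apply/funext => z; rewrite /F row_mxKl row_mxKr.
  apply: measurable_intM; last exact: mxmeas_row_mx.
  move=> d' Z' g' h' mg' mh'; apply: mf; rewrite /block_mx.
  apply: (@mxmeas_col_mx _ _ 1 p); apply: (@mxmeas_row_mx _ _ _ 1 q) => //.
  - by move=> i j; under eq_fun do rewrite mxE; exact: mg'.
  - by move=> i j; under eq_fun do rewrite !mxE; exact: mg'.
- by move=> u v; exact: intM_ge0.
Qed.

(** The integral unfolds row by row while the variational family factorises over columns;
    transposition reconciles the two. *)
Lemma intM_tr p q (f : 'M[R]_(p, q) -> \bar R) : mmeas f ->
  (forall A, 0 <= f A)%E -> intM f = intM (fun A : 'M[R]_(q, p) => f A^T).
Proof.
elim: p q f => [|p IH] q f mf f0.
  by rewrite /intM !intRn_dim0 ?muln0//; congr f; apply/matrixP => -[].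
rewrite intM_row intM_col//.
  apply: eq_intRn => u; rewrite IH//.
    apply: eq_intM => B; congr f; by rewrite (@tr_row_mx _ _ 1 p) trmxK.
  move=> d Z g mg; apply: mf; apply: (@mxmeas_col_mx _ _ 1) => //; exact: mxmeas_cst.
by move=> d Z g mg; apply: mf; exact: mxmeas_tr.
Qed.

Lemma intM_prod_rows n d (f : 'I_n -> 'rV[R]_d -> R) (c : 'I_n -> R) :
  (forall i, vmeas (fun v => (f i v)%:E)) -> (forall i v, 0 <= f i v) ->
  (forall i, intRn (fun v => (f i v)%:E) = (c i)%:E) ->
  intM (fun X : 'M[R]_(n, d) => (\prod_i f i (row i X))%:E) = (\prod_i c i)%:E.
Proof.
elim: n f c => [|n IH] f c mf f0 fc.
  by rewrite /intM intRn_dim0// !big_ord0.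
have c0 i : 0 <= c i by rewrite -lee_fin -fc; apply: intRn_ge0 => v; rewrite lee_fin.
rewrite intM_row big_ord_recl.
under eq_intRn => u.
  under eq_intM => X.
    rewrite big_ord_recl [row ord0 _](_ : _ = u); last first.
      apply/rowP => j; rewrite !mxE; case: splitP => [k _|k //].
      by rewrite (ord1 k).
    under eq_bigr => i _.
      rewrite [row _ _](_ : _ = row i X); last first.
        apply/rowP => j; rewrite !mxE; case: splitP => [k|k [ik]].
          by rewrite (ord1 k).
        by congr (X _ _); exact: val_inj.
      over.
    rewrite EFinM; over.
  rewrite ge0_intMZ//.
    rewrite (IH (fun i => f (lift ord0 i)) (fun i => c (lift ord0 i)))//.
    rewrite muleC; over.
  - move=> d' Z g mg; apply/measurable_EFinP; apply: measurable_prod => i _.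
    by apply/measurable_EFinP; apply: mf; exact: mxmeas_row.
  - by move=> X; rewrite lee_fin; apply: prodr_ge0.
rewrite ge0_intRnZ//; last by apply: prodr_ge0.
  by rewrite fc -EFinM mulrC.
by move=> v; rewrite lee_fin.
Qed.

End matrix_integral.

(** * Gaussian integrals and densities *)

Section gaussian_integrals.
Variable R : realType.
Local Notation leb := (@lebesgue_measure R).

Lemma integral_gauss1 (c m : R) : 0 < c ->
  (\int[leb]_x (expR (- (c * (x - m) ^+ 2) / 2))%:E =
   (expR ((ln (2 * pi) - ln c) / 2))%:E)%E.
Proof.
move=> c0; set s := (Num.sqrt c)^-1.
have s0 : s != 0 by rewrite invr_eq0 gt_eqF// sqrtr_gt0.
have pp : 0 < 2 * pi :> R by rewrite mulr_gt0 ?pi_gt0.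
have pk := normal_peak_gt0 s0.
transitivity (\int[leb]_x ((normal_peak s)^-1%:E * (normal_pdf m s x)%:E))%E.
  apply: eq_integral => x _; rewrite -EFinM normal_pdfE// mulKf ?gt_eqF//.
  congr (_%:E); congr expR; rewrite /s exprVn sqr_sqrtr ?(ltW c0)//.
  by field; rewrite gt_eqF.
rewrite integralZl//=; last exact: integrable_normal_pdf.
rewrite integral_normal_pdf mule1; congr (_%:E).
rewrite /normal_peak invrK /s exprVn sqr_sqrtr ?(ltW c0)//.
have -> : (ln (2 * pi) - ln c) / 2 = 2^-1 * ln (2 * pi / c).
  by rewrite ln_div ?posrE// mulrC.
rewrite -ln_powR lnK; last first.
  by rewrite posrE powR_gt0 ?divr_gt0.
rewrite powR12_sqrt ?divr_ge0 ?(ltW pp) ?(ltW c0)//.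
by congr Num.sqrt; field; rewrite gt_eqF.
Qed.

Lemma measurable_expR_qf d (Z : measurableType d) p (A : Z -> 'M[R]_p)
    (v : Z -> 'rV[R]_p) : mxmeas A -> mxmeas v ->
  measurable_fun setT (fun z => expR (- qf (A z) (v z) / 2)).
Proof.
move=> mA mv; apply: measurableT_comp => //; apply: measurable_funM => //.
by apply: measurableT_comp => //; exact: measurable_qf.
Qed.

Lemma vmeas_expR_qf p (A : 'M[R]_p) (mu : 'rV[R]_p) :
  vmeas (fun v => (expR (- qf A (v - mu) / 2))%:E).
Proof.
move=> d Z g mg; apply/measurable_EFinP.
apply: (@measurable_expR_qf _ _ _ (fun=> A) (fun z => g z - mu)).
  exact: mxmeas_cst.
by apply: mxmeasD => //; exact: mxmeas_cst.
Qed.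

(** After completing the square, the first coordinate only shifts the mean of the inner integral,
    whose value therefore does not depend on it. What remains is a one-dimensional Gaussian with
    precision [schur]. Values are kept in exponential form so that factors combine linearly. *)
Lemma intRn_gauss d (P : 'M[R]_d) (mu : 'rV[R]_d) : posdef P ->
  intRn (fun v => (expR (- qf P (v - mu) / 2))%:E) =
  (expR ((d%:R * ln (2 * pi) - ln (\det P)) / 2))%:E.
Proof.
elim: d P mu => [|d IH] P mu pP.
  by rewrite /= /qf thinmx0 !mul0mx mxE det_mx00 ln1 mul0r subrr oppr0 !mul0r.
have pQ := @posdef_drsubmx R d P pP.
have c0 := @posdef_schur_gt0 R d P pP.
set Q := drsubmx (P : 'M[R]_(1 + d)) in pQ *.
set c := schur (P : 'M[R]_(1 + d)) in c0 *.
set t := ursubmx (P : 'M[R]_(1 + d)) *m invmx Q.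
set m := mu 0 0; set mu' := rsubmx (mu : 'rV[R]_(1 + d)).
have muE : mu = row_mx (\row_(j < 1) m) mu'.
  rewrite -[LHS](@hsubmxK R 1 1 d).
  rewrite [lsubmx _](_ : _ = \row_(j < 1) m)//.
  by apply/rowP => i; rewrite !mxE; congr (mu _ _); apply: val_inj; rewrite /= ord1.
rewrite /=; under eq_integral => x _.
  rewrite (_ : (fun v => _) = (fun v : 'rV[R]_d =>
    (expR (- (c * (x - m) ^+ 2) / 2))%:E *
    (expR (- qf Q (v - (mu' - (x - m) *: t)) / 2))%:E)%E); last first.
    apply/funext => v; rewrite -EFinM -expRD; congr (expR _)%:E.
    rewrite [in LHS]muE [X in qf _ X](_ : _ = row_mx (x - m)%:M (v - mu')); last first.
      rewrite (@opp_row_mx R 1 1 d) (@add_row_mx R 1 1 d); congr (row_mx _ _).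
      by apply/rowP => i; rewrite !mxE (ord1 i) eqxx mulr1n.
    rewrite (@qf_schur R d P)// -/Q -/c -/t.
    rewrite [v - mu' + _](_ : _ = v - (mu' - (x - m) *: t)); first by lra.
    by rewrite opprB addrA addrAC.
  rewrite ge0_intRnZ; first 1 last.
  - exact: vmeas_expR_qf.
  - by move=> v; rewrite lee_fin expR_ge0.
  - exact: expR_ge0.
  rewrite IH// muleC; over.
rewrite ge0_integralZl_EFin; first 1 last.
- exact: measurableT.
- by move=> x _; rewrite lee_fin expR_ge0.
- apply/measurable_EFinP; apply: measurableT_comp => //.
  apply: measurable_funM => //; apply: measurableT_comp => //.
  apply: measurable_funM => //; under eq_fun do rewrite expr2.
  by apply: measurable_funM; apply: measurable_funB.
- exact: expR_ge0.
rewrite integral_gauss1// -EFinM -expRD; congr (expR _)%:E.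
rewrite (@det_schur R d P)// -/Q -/c [ln (c * _)]lnM ?posrE ?posdef_det_gt0//.
by rewrite -[d.+1%:R]natr1; lra.
Qed.

Lemma gauss_pdfE d (mu : 'rV[R]_d) (S : 'M[R]_d) x : posdef S ->
  gauss_pdf mu S x =
  expR (- (d%:R * ln (2 * pi) + ln (\det S)) / 2 - qf (invmx S) (x - mu) / 2).
Proof.
move=> pS; have dS := posdef_det_gt0 pS.
have pp : 0 < 2 * pi :> R by rewrite mulr_gt0 ?pi_gt0.
have ppd : 0 < (2 * pi) ^+ d :> R by rewrite exprn_gt0.
rewrite /gauss_pdf expRD; congr (_ * _); last by rewrite -mulNr.
rewrite mulNr expRN; congr (_^-1).
rewrite -powR12_sqrt ?mulr_ge0 ?(ltW ppd) ?(ltW dS)//.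
rewrite -[LHS]lnK ?posrE ?powR_gt0 ?mulr_gt0//; congr expR.
rewrite ln_powR lnM ?posrE// lnXn// mulr_natl; lra.
Qed.

Lemma gauss_pdf_gt0 d (mu : 'rV[R]_d) (S : 'M[R]_d) x : posdef S ->
  0 < gauss_pdf mu S x.
Proof. by move=> pS; rewrite gauss_pdfE// expR_gt0. Qed.

Lemma ln_gauss_pdf d (mu : 'rV[R]_d) (S : 'M[R]_d) x : posdef S ->
  ln (gauss_pdf mu S x) =
  - (d%:R * ln (2 * pi) + ln (\det S)) / 2 - qf (invmx S) (x - mu) / 2.
Proof. by move=> pS; rewrite gauss_pdfE// expRK. Qed.

Lemma measurable_gauss_pdf e (Z : measurableType e) d (S : Z -> 'M[R]_d)
    (mu x : Z -> 'rV[R]_d) :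
  (forall z, posdef (S z)) -> mxmeas S -> mxmeas mu -> mxmeas x ->
  measurable_fun setT (fun z => gauss_pdf (mu z) (S z) (x z)).
Proof.
move=> pS mS mmu mx; under eq_fun do rewrite gauss_pdfE//.
apply: measurableT_comp => //; apply: measurable_funB; apply: measurable_funM => //.
  apply: measurableT_comp => //; apply: measurable_funD => //.
  by apply: measurableT_comp; [exact: measurable_ln|exact: measurable_det].
apply: (@measurable_qf _ _ _ _ (fun z => invmx (S z)) (fun z => x z - mu z)).
  exact: mxmeas_inv.
by apply: mxmeasD => //; exact: mxmeasN.
Qed.

Lemma intRn_gauss_pdf d (mu : 'rV[R]_d) (S : 'M[R]_d) : posdef S ->
  intRn (fun x => (gauss_pdf mu S x)%:E) = 1%E.
Proof.
move=> pS; have pP := posdef_inv pS.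
under eq_intRn => x do rewrite gauss_pdfE// expRD EFinM -[- (qf _ _ / 2)]mulNr.
rewrite ge0_intRnZ; first 1 last.
- exact: vmeas_expR_qf.
- by move=> v; rewrite lee_fin expR_ge0.
- exact: expR_ge0.
rewrite intRn_gauss// -EFinM -expRD det_inv lnV ?posrE ?posdef_det_gt0//.
by rewrite [X in expR X](_ : _ = 0) ?expR0//; ring.
Qed.

Lemma mf_pdf_gt0 d K (mu : 'M[R]_(d, K)) (S : 'I_K -> 'M[R]_d) W :
  (forall j, posdef (S j)) -> 0 < mf_pdf mu S W.
Proof. by move=> pS; apply: prodr_gt0 => j _; exact: gauss_pdf_gt0. Qed.

Lemma measurable_mf_pdf e (Z : measurableType e) d K (mu : 'M[R]_(d, K))
    (S : 'I_K -> 'M[R]_d) (W : Z -> 'M[R]_(d, K)) :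
  (forall j, posdef (S j)) -> mxmeas W ->
  measurable_fun setT (fun z => mf_pdf mu S (W z)).
Proof.
move=> pS mW; apply: measurable_prod => j _.
apply: (@measurable_gauss_pdf _ _ _ (fun=> S j) (fun=> (col j mu)^T)
  (fun z => (col j (W z))^T)) => //; try exact: mxmeas_cst.
by apply: mxmeas_tr; exact: mxmeas_col.
Qed.

Lemma intM_mf_pdf d K (mu : 'M[R]_(d, K)) (S : 'I_K -> 'M[R]_d) :
  (forall j, posdef (S j)) -> intM (fun W => (mf_pdf mu S W)%:E) = 1%E.
Proof.
move=> pS; rewrite intM_tr; first 1 last.
- by move=> e Z g mg; apply/measurable_EFinP; exact: measurable_mf_pdf.
- by move=> W; rewrite lee_fin ltW// mf_pdf_gt0.
rewrite /mf_pdf; under eq_intM => A.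
  under eq_bigr => j _ do rewrite [(col j A^T)^T]tr_col trmxK.
  over.
rewrite (@intM_prod_rows R K d (fun j v => gauss_pdf (col j mu)^T (S j) v) (fun=> 1)).
- by rewrite big1.
- move=> j e Z g mg; apply/measurable_EFinP.
  by apply: (@measurable_gauss_pdf _ _ _ (fun=> S j) (fun=> (col j mu)^T)) => //;
    exact: mxmeas_cst.
- by move=> j v; rewrite ltW// gauss_pdf_gt0.
- by move=> j; rewrite intRn_gauss_pdf.
Qed.

End gaussian_integrals.

(** * Perturbation bounds for the PPCA log-likelihood *)

Section ppca_bounds.
Variable R : realType.
Variable sigma2 : R.
Hypothesis sigma2_gt0 : 0 < sigma2.

Lemma ppca_cov_posdef d K (W : 'M[R]_(d, K)) : posdef (ppca_cov sigma2 W).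
Proof.
split; first by rewrite /ppca_cov linearD/= trmx_mul trmxK tr_scalar_mx.
move=> v v0; rewrite mulmxDr mulmxDl mxE ltr_wpDl//.
  have := sqn_ge0 (v *m W); by rewrite /sqn trmx_mul !mulmxA.
exact: posdef_qf_gt0 (posdef_scalar _ sigma2_gt0) v0.
Qed.

Definition prec d K (W : 'M[R]_(d, K)) := invmx (ppca_cov sigma2 W).

Lemma prec_posdef d K (W : 'M[R]_(d, K)) : posdef (prec W).
Proof. exact/posdef_inv/ppca_cov_posdef. Qed.

Lemma dotmxC d (u v : 'rV[R]_d) : u *m v^T = v *m u^T.
Proof. by rewrite -[LHS]trmx11 trmx_mul trmxK. Qed.

Lemma sqnD d (u v : 'rV[R]_d) : sqn (u + v) = sqn u + 2 * (u *m v^T) 0 0 + sqn v.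
Proof.
rewrite /sqn linearD/= mulmxDl !mulmxDr (dotmxC v u) !mxE; ring.
Qed.

Lemma sqnB d (u v : 'rV[R]_d) : sqn (u - v) = sqn u - 2 * (u *m v^T) 0 0 + sqn v.
Proof.
rewrite /sqn linearB/= mulmxBl !mulmxBr (dotmxC v u) !mxE; ring.
Qed.

Lemma sqnZ d (c : R) (v : 'rV[R]_d) : sqn (c *: v) = c ^+ 2 * sqn v.
Proof. by rewrite /sqn linearZ/= -scalemxAl -scalemxAr scalerA mxE expr2. Qed.

(* sigma2 * qf (prec W) x is the minimal value over z of the ridge regression
   objective, attained at z = x *m prec W *m W. *)
Lemma ridge d K (W : 'M[R]_(d, K)) (x : 'rV[R]_d) (z : 'rV[R]_K) :
  let u := x *m prec W *m W in
  sqn (x - z *m W^T) + sigma2 * sqn z =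
  sigma2 * qf (prec W) x + sigma2 * sqn (u - z) + sqn ((u - z) *m W^T).
Proof.
move=> u; set y := x *m prec W.
(* This is [y *m ppca_cov sigma2 W = x], expanded. *)
have xE : x = u *m W^T + sigma2 *: y.
  rewrite -mul_mx_scalar -[u *m _]mulmxA -mulmxDr.
  by rewrite /y mulmxKV// posdef_unitmx//; exact: ppca_cov_posdef.
have -> : x - z *m W^T = sigma2 *: y + (u - z) *m W^T.
  by rewrite {1}xE mulmxBl addrAC addrC addrA.
have -> : qf (prec W) x = sqn u + sigma2 * sqn y.
  rewrite /qf -/y {1}xE linearD linearZ/= mulmxDr trmx_mul trmxK mulmxA.
  rewrite -scalemxAr [LHS]mxE; congr (_ + _); by rewrite mxE.
rewrite sqnD sqnZ.
have -> : (sigma2 *: y *m ((u - z) *m W^T)^T) 0 0 = sigma2 * (u *m (u - z)^T) 0 0.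
  by rewrite trmx_mul trmxK mulmxA -!scalemxAl mxE.
have -> : sqn z = sqn u - 2 * (u *m (u - z)^T) 0 0 + sqn (u - z).
  by rewrite -[in LHS](subKr u z) sqnB.
ring.
Qed.

(** The ridge objective at zero dominates its minimum. *)
Lemma qf_prec_le d K (W : 'M[R]_(d, K)) (x : 'rV[R]_d) :
  qf (prec W) x <= sqn x / sigma2.
Proof.
have := ridge W x 0; rewrite /= mul0mx subr0 sqn0 mulr0 addr0 => ->.
rewrite ler_pdivlMr// mulrC -addrA lerDl addr_ge0 ?sqn_ge0//.
by rewrite mulr_ge0 ?sqn_ge0 ?ltW.
Qed.

(** At the minimiser, the penalty alone is at most the minimal value. *)
Lemma sqn_ridge_coef_le d K (W : 'M[R]_(d, K)) (x : 'rV[R]_d) :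
  sqn (x *m prec W *m W) <= qf (prec W) x.
Proof.
have := ridge W x (x *m prec W *m W); rewrite /= subrr mul0mx !sqn0 mulr0 !addr0.
move=> e; rewrite -(ler_pM2l sigma2_gt0) -e lerDr; exact: sqn_ge0.
Qed.

(* Evaluating the ridge objective of W0 + V at the optimal coefficients of W0. *)
Lemma qf_prec_perturb d K (W0 V : 'M[R]_(d, K)) (x : 'rV[R]_d) (z : 'rV[R]_K) :
  z = x *m prec W0 *m W0 ->
  qf (prec (W0 + V)) x <= qf (prec W0) x
    + sigma2^-1 * (- 2 * ((x - z *m W0^T) *m (z *m V^T)^T) 0 0 + sqn z * frob V).
Proof.
move=> zE; have r1 := ridge (W0 + V) x z; have r0 := ridge W0 x z.
move: r1 r0 => /=; rewrite -zE subrr mul0mx !sqn0 mulr0 !addr0.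
rewrite [(W0 + V)^T]linearD/= mulmxDr opprD addrA [sqn (_ - z *m V^T)]sqnB.
set T := sqn (_ - _ : 'rV_K); set T' := sqn (_ *m (W0^T + V^T)).
have T0 : 0 <= T by exact: sqn_ge0.
have T0' : 0 <= T' by exact: sqn_ge0.
have := sqn_mulmx_le z V^T; rewrite frob_tr.
set I := (_ *m _) 0 0; set S1 := sqn (z *m V^T); set FV := frob V.
set S0 := sqn (x - _).
set Q1 := qf _ _; set Q0 := qf _ _ => hS r1 r0.
have -> : Q0 + sigma2^-1 * (- 2 * I + sqn z * FV) =
  sigma2^-1 * (sigma2 * Q0 + (- 2 * I + sqn z * FV)).
  by field; rewrite gt_eqF.
rewrite ler_pdivlMl//.
have : 0 <= sigma2 * T by rewrite mulr_ge0// ltW.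
lra.
Qed.

Lemma trace_prec_le d K (W0 : 'M[R]_(d, K)) K' (V : 'M[R]_(d, K')) :
  \tr (prec W0 *m (V *m V^T)) <= frob V / sigma2.
Proof.
have -> : \tr (prec W0 *m (V *m V^T)) = \sum_k qf (prec W0) (col k V)^T.
  rewrite mulmxA mxtrace_mulC mulmxA /mxtrace; apply: eq_bigr => k _.
  rewrite /qf trmxK.
  have -> : (col k V)^T = row k V^T by rewrite tr_col.
  rewrite -!row_mul.
  by rewrite !mxE; apply: eq_bigr => i _; rewrite !mxE.
rewrite /frob exchange_big/= mulr_suml; apply: ler_sum => k _.
apply: (le_trans (qf_prec_le _ _)); rewrite ler_wpM2r ?invr_ge0 ?(ltW sigma2_gt0)//.
by rewrite sqnE; apply: ler_sum => i _; rewrite !mxE.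
Qed.

(** The tangent inequality at the covariance of [W0]: the two cross terms have the same trace, and
    the term [V *m V^T] is controlled by [trace_prec_le]. *)
Lemma ln_det_cov_perturb d K (W0 V : 'M[R]_(d, K)) :
  ln (\det (ppca_cov sigma2 (W0 + V))) <= ln (\det (ppca_cov sigma2 W0))
    + 2 * \tr (prec W0 *m W0 *m V^T) + frob V / sigma2.
Proof.
have p0 := ppca_cov_posdef W0; have u0 := posdef_unitmx p0.
have := ln_det_tangent p0 (ppca_cov_posdef (W0 + V)).
have -> : ppca_cov sigma2 (W0 + V) =
  ppca_cov sigma2 W0 + (W0 *m V^T + V *m W0^T + V *m V^T).
  rewrite /ppca_cov linearD/= mulmxDl !mulmxDr.
  move: (W0 *m W0^T) (W0 *m V^T) (V *m W0^T) (V *m V^T) => A B C D.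
  by apply/matrixP => i j; rewrite !mxE; ring.
rewrite mulmxDr mulVmx// linearD/= mxtrace1 -/(prec W0) !mulmxDr !linearD/=.
have -> : \tr (prec W0 *m (V *m W0^T)) = \tr (prec W0 *m (W0 *m V^T)).
  rewrite -[LHS]mxtrace_tr !trmx_mul trmxK (posdef_sym (prec_posdef W0)).
  by rewrite mxtrace_mulC.
rewrite !mulmxA -[prec W0 *m V *m V^T]mulmxA.
have := trace_prec_le W0 V; lra.
Qed.

Lemma frob_le_bounded d K (W : 'M[R]_(d, K)) (C : R) : (forall i j, `|W i j| <= C) ->
  frob W <= (d * K)%:R * C ^+ 2.
Proof.
move=> WC; apply: (@le_trans _ _ (\sum_(i < d) \sum_(j < K) C ^+ 2)).
  apply: ler_sum => i _; apply: ler_sum => j _.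
  rewrite -[W i j ^+ 2]real_normK ?num_real//.
  have C0 : 0 <= C by exact: le_trans (normr_ge0 _) (WC i j).
  by rewrite ler_sqr ?nnegrE.
under eq_bigr do rewrite sumr_const card_ord.
by rewrite sumr_const card_ord -mulrnA mulnC mulr_natl.
Qed.

Lemma ppca_pdf_gt0 d K (W : 'M[R]_(d, K)) x : 0 < ppca_pdf sigma2 W x.
Proof. exact/gauss_pdf_gt0/ppca_cov_posdef. Qed.

Lemma ln_ppca_pdf d K (W : 'M[R]_(d, K)) x : ln (ppca_pdf sigma2 W x) =
  - (d%:R * ln (2 * pi) + ln (\det (ppca_cov sigma2 W))) / 2 - qf (prec W) x / 2.
Proof. by rewrite ln_gauss_pdf ?subr0//; exact: ppca_cov_posdef. Qed.

Definition dotM p q (A B : 'M[R]_(p, q)) : R := \sum_i \sum_j A i j * B i j.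

Lemma trace_dotM p q (A B : 'M[R]_(p, q)) : \tr (A *m B^T) = dotM A B.
Proof.
by rewrite /mxtrace /dotM; apply: eq_bigr => i _; rewrite mxE; apply: eq_bigr => j _;
  rewrite mxE.
Qed.

(** Only the quadratic coefficient needs to be explicit. The linear form may stay unspecified, since
    [iso_moment_le] bounds its contribution whatever its size. *)
Lemma loglik_perturb n d K (X : 'M[R]_(n, d)) (W0 : 'M[R]_(d, K)) :
  exists A : 'M[R]_(d, K), forall V,
    loglik sigma2 X W0 - loglik sigma2 X (W0 + V) <= dotM A V +
    (n%:R + \sum_i qf (prec W0) (row i X)) / (2 * sigma2) * frob V.
Proof.
pose z i := row i X *m prec W0 *m W0.
pose r i := row i X - z i *m W0^T.
(* Minus the gradient of the log-likelihood at [W0]: the first term comes from the log-determinant,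
   the second from the ridge residuals [r i] and coefficients [z i]. *)
exists (n%:R *: (prec W0 *m W0) - sigma2^-1 *: \sum_i (r i)^T *m z i) => V.
have s0 : sigma2 != 0 by rewrite gt_eqF.
apply: (@le_trans _ _ (\sum_(i < n)
   ((\tr (prec W0 *m W0 *m V^T) - sigma2^-1 * \tr ((r i)^T *m z i *m V^T))
    + (1 + qf (prec W0) (row i X)) / (2 * sigma2) * frob V))).
  rewrite /loglik -sumrB; apply: ler_sum => i _; rewrite !ln_ppca_pdf.
  have h1 := ln_det_cov_perturb W0 V.
  have h2 := qf_prec_perturb V (erefl (z i)).
  have h3 := sqn_ridge_coef_le W0 (row i X).
  rewrite -/(r i) in h2; rewrite -/(z i) in h3.
  have -> : \tr ((r i)^T *m z i *m V^T) = (r i *m (z i *m V^T)^T) 0 0.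
    by rewrite -mulmxA mxtrace_mulC trace_mx11 dotmxC.
  have F0 := frob_ge0 V.
  have h4 : sqn (z i) * frob V <= qf (prec W0) (row i X) * frob V by rewrite ler_wpM2r.
  move: h1 h2 h4; set Q1 := qf (prec (W0 + V)) _; set Q0 := qf (prec W0) _.
  set I := (_ *m _) 0 0; set T := \tr _; set L1 := ln (\det _).
  set L0 := ln (\det _) => h1 h2 h4.
  have h5 : sigma2^-1 * (-2 * I + sqn (z i) * frob V) <=
    sigma2^-1 * (-2 * I + Q0 * frob V).
    by rewrite ler_pM2l ?invr_gt0// lerD2l.
  have -> : (1 + Q0) / (2 * sigma2) * frob V =
    2^-1 * (frob V / sigma2) + 2^-1 * (sigma2^-1 * (Q0 * frob V)) by field.
  lra.
rewrite big_split/= sumrB sumr_const card_ord -mulr_suml -mulr_suml big_split/=.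
rewrite sumr_const card_ord -mulr_sumr.
rewrite lerD2r -trace_dotM mulmxBl linearB/= -!scalemxAl !linearZ/=.
rewrite mulmx_suml linear_sum/=.
by rewrite mulr_natl sumrN (raddf_sum (@mxtrace R d)).
Qed.

Lemma ln_det_cov_le d K (W : 'M[R]_(d, K)) :
  ln (\det (ppca_cov sigma2 W)) <= frob W + d%:R * sigma2.
Proof.
apply: (le_trans (ln_det_le_trace (ppca_cov_posdef W))).
rewrite /ppca_cov linearD/= mxtrace_scalar trace_dotM mulr_natl.
rewrite (_ : dotM W W = frob W) ?gerDl ?oppr_le0 ?ler0n//.
Qed.

(** The trace bound applied to the precision matrix, whose trace is at most d / sigma2. *)
Lemma ln_det_cov_ge d K (W : 'M[R]_(d, K)) :
  - (d%:R / sigma2) <= ln (\det (ppca_cov sigma2 W)).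
Proof.
have dS := posdef_det_gt0 (ppca_cov_posdef W).
have := ln_det_le_trace (prec_posdef W).
rewrite det_inv lnV ?posrE// => h.
have : \tr (prec W) <= d%:R / sigma2.
  have := trace_prec_le W (1%:M : 'M[R]_d).
  rewrite trmx1 !mulmx1; suff -> : frob (1%:M : 'M[R]_d) = d%:R by [].
  rewrite /frob; under eq_bigr => i _.
    rewrite (bigD1 i)//= big1 ?addr0; last first.
      by move=> j ji; rewrite mxE eq_sym (negbTE ji) expr0n.
    rewrite mxE eqxx expr1n; over.
  by rewrite sumr_const card_ord.
have : 0 <= d%:R :> R by [].
lra.
Qed.

(** A crude quadratic growth bound that serves integrability against Gaussian densities; its
    constants do not enter the rate. *)
Lemma loglik_bound n d K (X : 'M[R]_(n, d)) :
  exists A B : R, 0 <= B /\ forall W : 'M[R]_(d, K),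
    `|loglik sigma2 X W| <= A + B * frob W.
Proof.
exists (\sum_(i < n) (d%:R * `|ln (2 * pi)| + d%:R * sigma2 + d%:R / sigma2
          + sqn (row i X) / sigma2)), n%:R; split; first exact: ler0n.
move=> W; rewrite /loglik.
apply: (le_trans (ler_norm_sum _ _ _)).
have -> : n%:R * frob W = \sum_(i < n) frob W by rewrite sumr_const card_ord mulr_natl.
rewrite -big_split/=; apply: ler_sum => i _; rewrite ln_ppca_pdf.
have h1 := ln_det_cov_le W; have h2 := ln_det_cov_ge W.
have h3 := qf_prec_le W (row i X).
have h4 := posdef_qf_ge0 (row i X) (prec_posdef W).
have F0 := frob_ge0 W.
have p1 : - (d%:R * `|ln (2 * pi)|) <= d%:R * ln (2 * pi) :> R.
  by rewrite -mulrN ler_wpM2l// lerNl -normrN ler_norm.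
have p2 : d%:R * ln (2 * pi) <= d%:R * `|ln (2 * pi)| :> R.
  by rewrite ler_wpM2l// ler_norm.
have s0 : 0 <= d%:R * sigma2 by rewrite mulr_ge0// ltW.
have s1 : 0 <= d%:R / sigma2 by rewrite divr_ge0// ltW.
rewrite ler_norml; apply/andP; split; lra.
Qed.

Lemma measurable_ppca_pdf e (Z : measurableType e) d K
    (W : Z -> 'M[R]_(d, K)) (x : Z -> 'rV[R]_d) : mxmeas W -> mxmeas x ->
  measurable_fun setT (fun z => ppca_pdf sigma2 (W z) (x z)).
Proof.
move=> mW mx.
apply: (@measurable_gauss_pdf _ _ _ _ (fun z => ppca_cov sigma2 (W z)) (fun=> 0)) => //.
- by move=> z; exact: ppca_cov_posdef.
- apply: mxmeasD; last exact: mxmeas_cst.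
  by apply: mxmeasM => //; exact: mxmeas_tr.
Qed.

Lemma measurable_loglik e (Z : measurableType e) n d K
    (W : Z -> 'M[R]_(d, K)) (X : Z -> 'M[R]_(n, d)) : mxmeas W -> mxmeas X ->
  measurable_fun setT (fun z => loglik sigma2 (X z) (W z)).
Proof.
move=> mW mX; apply: measurable_sum => i.
apply: measurableT_comp; first exact: measurable_ln.
by apply: measurable_ppca_pdf => //; exact: mxmeas_row.
Qed.

End ppca_bounds.

(** * Gaussian domination and moment bounds *)

Section gaussian_moments.
Variable R : realType.

(** The value of the integral is paired with Gaussian domination, which is what makes the iterated
    integral linear on signed integrands. *)
Definition hasint p q (f : 'M[R]_(p, q) -> R) (r : R) :=
  gdom (fun v => f (vec_mx v)) /\ intM (fun A => (f A)%:E) = r%:E.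

Lemma gdom_lin m (a b : R) (f g : 'rV[R]_m -> R) : gdom f -> gdom g ->
  gdom (fun v => a * f v + b * g v).
Proof.
move=> [mf [C [e [e0 fC]]]] [mg [D [e' [e'0 gD]]]]; split.
  move=> d Z h mh; apply/measurable_EFinP; apply: measurable_funD.
    by apply: measurable_funM => //; apply/measurable_EFinP; exact: mf.
  by apply: measurable_funM => //; apply/measurable_EFinP; exact: mg.
have C0 : 0 <= C.
  by have := le_trans (normr_ge0 _) (fC 0); rewrite pmulr_lge0// expR_gt0.
have D0 : 0 <= D.
  by have := le_trans (normr_ge0 _) (gD 0); rewrite pmulr_lge0// expR_gt0.
exists (`|a| * C + `|b| * D), (Num.min e e'); split.
  by rewrite lt_min e0 e'0.
move=> v; apply: (le_trans (ler_normD _ _)); rewrite !normrM mulrDl.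
have sv := sqn_ge0 v.
apply: lerD; rewrite -mulrA ler_wpM2l ?normr_ge0//.
- apply: (le_trans (fC v)); rewrite ler_wpM2l// ler_expR !mulNr lerN2.
  by rewrite ler_wpM2r// ge_min lexx.
- apply: (le_trans (gD v)); rewrite ler_wpM2l// ler_expR !mulNr lerN2.
  by rewrite ler_wpM2r// ge_min lexx orbT.
Qed.

Lemma hasint_lin p q (a b : R) (f g : 'M[R]_(p, q) -> R) r s :
  hasint f r -> hasint g s -> hasint (fun A => a * f A + b * g A) (a * r + b * s).
Proof.
move=> [gf fr] [gg gs]; split; first exact: gdom_lin.
rewrite /intM gdom_intRn_lin//.
by move: fr gs; rewrite /intM => -> ->; rewrite -!EFinM -EFinD.
Qed.

Lemma hasint0 p q : hasint (fun _ : 'M[R]_(p, q) => 0) 0.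
Proof.
split; last by rewrite /intM intRn_cst0.
split; first by move=> d Z g mg; exact: measurable_cst.
by exists 0, 1; split => // v; rewrite normr0 mul0r.
Qed.

Lemma eq_hasint p q (f g : 'M[R]_(p, q) -> R) r s : f =1 g -> r = s ->
  hasint f r -> hasint g s.
Proof. by move=> /funext -> ->. Qed.

Lemma hasintD p q (f g : 'M[R]_(p, q) -> R) r s :
  hasint f r -> hasint g s -> hasint (fun A => f A + g A) (r + s).
Proof.
move=> hf hg; apply: eq_hasint (hasint_lin 1 1 hf hg) => [A|]; by rewrite !mul1r.
Qed.

Lemma hasintZ p q (a : R) (f : 'M[R]_(p, q) -> R) r :
  hasint f r -> hasint (fun A => a * f A) (a * r).
Proof.
move=> hf; apply: eq_hasint (hasint_lin a 0 hf hf) => [A|];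
  by rewrite mul0r addr0.
Qed.

Lemma hasint_sum p q (I : Type) (s : seq I) (f : I -> 'M[R]_(p, q) -> R) r :
  (forall i, hasint (f i) (r i)) ->
  hasint (fun A => \sum_(i <- s) f i A) (\sum_(i <- s) r i).
Proof.
move=> h; elim: s => [|i s IH].
  apply: eq_hasint (hasint0 p q) => [A|]; by rewrite big_nil.
apply: eq_hasint (hasintD (h i) IH) => [A|]; by rewrite big_cons.
Qed.

Lemma hasint_le p q (f g : 'M[R]_(p, q) -> R) r s : (forall A, f A <= g A) ->
  hasint f r -> hasint g s -> r <= s.
Proof.
move=> fg [_ fr] [_ gs]; rewrite -lee_fin -fr -gs; apply: le_intM => A.
by rewrite lee_fin.
Qed.

Lemma gdom_hasint p q (f : 'M[R]_(p, q) -> R) : gdom (fun v => f (vec_mx v)) ->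
  exists r, hasint f r.
Proof.
move=> gf; exists (fine (intM (fun A => (f A)%:E))); split => //.
by rewrite fineK//; exact: gdom_intRn gf.
Qed.

Lemma frob_vec_mx p q (v : 'rV[R]_(p * q)) : frob (vec_mx v) = sqn v.
Proof.
rewrite /frob sqnE pair_bigA/= (reindex _ (curry_mxvec_bij p q))/=.
by apply: eq_big => [[i j]//|[i j] _]; rewrite mxE.
Qed.

Lemma frob_cols p q (W : 'M[R]_(p, q)) : frob W = \sum_j sqn (col j W)^T.
Proof.
rewrite /frob exchange_big/=; apply: eq_bigr => j _; rewrite sqnE.
by apply: eq_bigr => i _; rewrite !mxE.
Qed.

Lemma gauss_pdf_le d (mu : 'rV[R]_d) (S : 'M[R]_d) : posdef S ->
  exists c e : R, 0 < e /\ forall x, gauss_pdf mu S x <= expR (c - e * sqn x).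
Proof.
move=> pS; have [e e0 he] := posdef_coercive (posdef_inv pS).
(* The rate e / 4 combines the factor 1/2 in the exponent with |x|^2 <= 2 |x - mu|^2 + 2 |mu|^2. *)
exists (- (d%:R * ln (2 * pi) + ln (\det S)) / 2 + e / 2 * sqn mu), (e / 4).
split => [|x]; first by rewrite divr_gt0.
rewrite gauss_pdfE// ler_expR; have h := he (x - mu).
have := sqnD_le (x - mu) mu; rewrite subrK => h2.
have : e * sqn x <= e * (2 * sqn (x - mu) + 2 * sqn mu) by rewrite ler_wpM2l// ltW.
lra.
Qed.

Lemma mf_pdf_le d K (mu : 'M[R]_(d, K)) (S : 'I_K -> 'M[R]_d) :
  (forall j, posdef (S j)) ->
  exists c e : R, 0 < e /\ forall W, mf_pdf mu S W <= expR (c - e * frob W).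
Proof.
move=> pS.
have /choice[ce hce] : forall j, exists p : R * R, 0 < p.2 /\
    forall x, gauss_pdf (col j mu)^T (S j) x <= expR (p.1 - p.2 * sqn x).
  by move=> j; have [c [e h]] := gauss_pdf_le (col j mu)^T (pS j); exists (c, e).
have e0 : 0 < 1 + \sum_j (ce j).2^-1.
  rewrite ltr_pwDl// sumr_ge0// => j _; rewrite invr_ge0 ltW//.
  by have [] := hce j.
(* The inverse of 1 plus the sum of the inverse rates is below every column's rate, and positive
   even without columns. *)
exists (\sum_j (ce j).1), (1 + \sum_j (ce j).2^-1)^-1; split.
  by rewrite invr_gt0.
move=> W; rewrite frob_cols mulr_sumr -sumrB expR_sum; apply: ler_prod => j _.
have [p2 h] := hce j.
rewrite ltW ?gauss_pdf_gt0//=; apply: (le_trans (h _)).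
rewrite ler_expR lerD2l lerN2 ler_wpM2r ?sqn_ge0//.
rewrite -[leRHS]invrK lef_pV2 ?posrE ?invr_gt0//.
rewrite (bigD1 j)//= addrCA lerDl addr_ge0// sumr_ge0// => i _.
by rewrite invr_ge0 ltW//; have [] := hce i.
Qed.

Lemma gdom_mf_pdf d K (mu : 'M[R]_(d, K)) (S : 'I_K -> 'M[R]_d)
    (f : 'M[R]_(d, K) -> R) (A B : R) :
  (forall j, posdef (S j)) ->
  (forall e (Z : measurableType e) (g : Z -> 'M[R]_(d, K)), mxmeas g ->
    measurable_fun setT (fun z => f (g z))) ->
  0 <= B -> (forall W, `|f W| <= A + B * frob W) ->
  gdom (fun v => f (vec_mx v) * mf_pdf mu S (vec_mx v)).
Proof.
move=> pS mf B0 fAB; have [c [e [e0 qe]]] := mf_pdf_le mu pS.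
split.
  move=> d' Z g mg; apply/measurable_EFinP; apply: measurable_funM.
    by apply: mf; exact: mxmeas_vec_mx.
  by apply: measurable_mf_pdf => //; exact: mxmeas_vec_mx.
(* Half of the Gaussian rate is kept for the domination; the other half absorbs the growth of [f]
   through t <= (2 / e) exp(e t / 2). *)
exists ((`|A| + B * (2 / e)) * expR c), (e / 2); split; first by rewrite divr_gt0.
move=> v; rewrite normrM [X in _ * X]gtr0_norm ?mf_pdf_gt0//.
have := qe (vec_mx v); have := fAB (vec_mx v); rewrite frob_vec_mx.
set t := sqn v; have t0 : 0 <= t by exact: sqn_ge0.
move=> h1 h2.
have h3 : `|f (vec_mx v)| <= (`|A| + B * (2 / e)) * expR (e / 2 * t).
  apply: (le_trans h1).
  have x1 : 1 <= expR (e / 2 * t) by rewrite -expR0 ler_expR mulr_ge0// divr_ge0// ltW.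
  have x2 : t <= 2 / e * expR (e / 2 * t).
    have := expR_ge1Dx (e / 2 * t) => x2.
    rewrite -ler_pdivrMl ?divr_gt0// invf_div; lra.
  have A1 : A <= `|A| * expR (e / 2 * t).
    apply: (le_trans (ler_norm _)); by rewrite ler_peMr.
  have B1 : B * t <= B * (2 / e * expR (e / 2 * t)) by rewrite ler_wpM2l.
  lra.
have -> : (`|A| + B * (2 / e)) * expR c * expR (- (e / 2) * t) =
  (`|A| + B * (2 / e)) * expR (e / 2 * t) * expR (c - e * t).
  by rewrite -!mulrA -!expRD; congr (_ * expR _); field.
by apply: ler_pM => //; rewrite ltW// mf_pdf_gt0.
Qed.

Lemma hasint_mf_pdf d K (mu : 'M[R]_(d, K)) (S : 'I_K -> 'M[R]_d) :
  (forall j, posdef (S j)) -> hasint (mf_pdf mu S) 1.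
Proof.
move=> pS; split; last exact: intM_mf_pdf.
have := @gdom_mf_pdf _ _ mu S (fun=> 1) 1 0 pS.
under eq_fun do rewrite mul1r.
by apply => // W; rewrite normr1 mul0r addr0.
Qed.

(** Expanding 0 <= |v P - v|^2 bounds twice the form by |v P|^2 + |v|^2. *)
Lemma qf_le_frob d (P : 'M[R]_d) (v : 'rV[R]_d) :
  qf P v <= (frob P + 1) * sqn v.
Proof.
have h := sqn_ge0 (v *m P - v); rewrite sqnB in h.
have := sqn_mulmx_le v P; rewrite -/(qf P v) in h.
have := sqn_ge0 v; have := mulr_ge0 (frob_ge0 P) (sqn_ge0 v).
lra.
Qed.

Lemma ln_prod (I : Type) (s : seq I) (f : I -> R) : (forall i, 0 < f i) ->
  ln (\prod_(i <- s) f i) = \sum_(i <- s) ln (f i).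
Proof.
move=> f0; elim: s => [|i s IH]; first by rewrite !big_nil ln1.
by rewrite !big_cons lnM ?posrE ?IH// prodr_gt0.
Qed.

Lemma ln_mf_pdf d K (mu : 'M[R]_(d, K)) (S : 'I_K -> 'M[R]_d) W :
  (forall j, posdef (S j)) ->
  ln (mf_pdf mu S W) = \sum_j ln (gauss_pdf (col j mu)^T (S j) (col j W)^T).
Proof. by move=> pS; rewrite ln_prod// => j; exact: gauss_pdf_gt0. Qed.

Lemma ln_mf_pdf_bound d K (mu : 'M[R]_(d, K)) (S : 'I_K -> 'M[R]_d) :
  (forall j, posdef (S j)) ->
  exists A B : R, 0 <= B /\ forall W, `|ln (mf_pdf mu S W)| <= A + B * frob W.
Proof.
move=> pS.
exists (\sum_j (`|d%:R * ln (2 * pi) + ln (\det (S j))|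
   + (frob (invmx (S j)) + 1) * (2 * sqn (col j mu)^T))),
  (\sum_j 2 * (frob (invmx (S j)) + 1)); split.
  by apply: sumr_ge0 => j _; rewrite mulr_ge0// addr_ge0// frob_ge0.
move=> W; rewrite ln_mf_pdf// frob_cols.
apply: (le_trans (ler_norm_sum _ _ _)).
rewrite mulr_suml -big_split/=; apply: ler_sum => j _.
rewrite ln_gauss_pdf//.
set P := invmx (S j); set x := (col j W)^T; set m := (col j mu)^T.
have pP : posdef P by exact: posdef_inv.
have q0 := posdef_qf_ge0 (x - m) pP.
have q1 := qf_le_frob P (x - m).
have sx : sqn x <= \sum_k sqn (col k W)^T.
  by rewrite (bigD1 j)//= lerDl sumr_ge0// => i _; exact: sqn_ge0.
have sB : sqn (x - m) <= 2 * sqn x + 2 * sqn m.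
  by have := sqnD_le x (- m); rewrite -[- m]scaleN1r sqnZ sqrrN expr1n mul1r.
have F0 := frob_ge0 P.
have h1 : (frob P + 1) * sqn (x - m) <=
    (frob P + 1) * (2 * \sum_k sqn (col k W)^T + 2 * sqn m).
  by rewrite ler_wpM2l ?addr_ge0//; lra.
set L := d%:R * _ + _.
have l1 := ler_norm L; have l2 := ler_norm (- L); rewrite normrN in l2.
have := sqn_ge0 (x - m).
have n0 := normr_ge0 L.
by rewrite ler_norml => _; apply/andP; split; lra.
Qed.

(** Both the prior and the comparison member of the variational family have this form. *)
Definition iso (t : R) d K (mu : 'M[R]_(d, K)) : 'M[R]_(d, K) -> R :=
  mf_pdf mu (fun=> t%:M).

Lemma isoE (t : R) d K (mu W : 'M[R]_(d, K)) : 0 < t ->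
  iso t mu W =
  expR (- ((d * K)%:R * (ln (2 * pi) + ln t)) / 2 - frob (W - mu) / (2 * t)).
Proof.
move=> t0; have pS (j : 'I_K) : posdef (t%:M : 'M[R]_d) by exact: posdef_scalar.
rewrite -[LHS]lnK ?posrE ?mf_pdf_gt0//; congr expR.
rewrite ln_mf_pdf// frob_cols.
have -> : - ((d * K)%:R * (ln (2 * pi) + ln t)) / 2 =
    \sum_(j < K) - (d%:R * (ln (2 * pi) + ln t)) / 2.
  by rewrite sumr_const card_ord -[RHS]mulr_natl natrM; lra.
rewrite mulr_suml -sumrB; apply: eq_bigr => j _; rewrite ln_gauss_pdf; last exact: pS.
rewrite det_scalar lnXn// -[ln t *+ d]mulr_natl invmx_scalar.
have -> : qf (t^-1%:M) ((col j W)^T - (col j mu)^T) = t^-1 * sqn (col j (W - mu))^T.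
  rewrite !linearB/= /qf mul_mx_scalar -scalemxAl mxE; by [].
by field; rewrite gt_eqF.
Qed.

Lemma hasint_iso (t : R) d K (mu : 'M[R]_(d, K)) : 0 < t -> hasint (iso t mu) 1.
Proof. by move=> t0; apply: hasint_mf_pdf => j; exact: posdef_scalar. Qed.

Lemma iso_tilt (t : R) d K (mu A V : 'M[R]_(d, K)) : 0 < t ->
  iso t mu (mu + V) * expR (dotM A V) =
  expR (t * frob A / 2) * iso t (mu + t *: A) (mu + V).
Proof.
move=> t0; rewrite !isoE// -!expRD; congr expR.
have -> : mu + V - mu = V by rewrite addrC addKr.
have -> : frob (mu + V - (mu + t *: A)) =
    frob V - 2 * t * dotM A V + t ^+ 2 * frob A.
  rewrite opprD addrACA subrr add0r /frob /dotM !mulr_sumr -sumrB -big_split/=.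
  apply: eq_bigr => i _; rewrite !mulr_sumr -sumrB -big_split/=.
  by apply: eq_bigr => j _; rewrite !mxE; ring.
field; by rewrite gt_eqF.
Qed.

Lemma expR_half_le2 : expR (2^-1) <= 2 :> R.
Proof.
have h := @expR_ge1Dx R (- 2^-1).
have e : expR (2^-1) * expR (- 2^-1) = 1 :> R by rewrite -expRD subrr expR0.
have := expR_gt0 (2^-1 : R); nra.
Qed.

(** The right-hand side is four times the square of exp(x / 2) - exp(- x / 2), a difference that is
    at least x / 2 when x >= 0. *)
Lemma sqr_le_cosh (x : R) : x ^+ 2 <= 4 * (expR x + expR (- x) - 2).
Proof.
wlog x0 : x / 0 <= x.
  move=> h; have [/h//|x0] := leP 0 x.
  have h' : (- x) ^+ 2 <= 4 * (expR (- x) + expR (- - x) - 2) by apply: h; lra.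
  by rewrite sqrrN opprK in h'; lra.
have h1 := @expR_ge1Dx R (x / 2).
have h2 : expR (- (x / 2)) <= 1 by rewrite -[leRHS]expR0 ler_expR; lra.
have e1 : expR x = expR (x / 2) ^+ 2 by rewrite expr2 -expRD; congr expR; lra.
have e2 : expR (- x) = expR (- (x / 2)) ^+ 2 by rewrite expr2 -expRD; congr expR; lra.
have e3 : expR (x / 2) * expR (- (x / 2)) = 1 by rewrite -expRD subrr expR0.
rewrite e1 e2; set a := expR (x / 2) in h1 e3 *; set b := expR (- (x / 2)) in h2 e3 *.
have ab : x / 2 <= a - b by lra.
have : (x / 2) ^+ 2 <= (a - b) ^+ 2.
  by rewrite ler_sqr ?nnegrE//; lra.
have -> : a ^+ 2 + b ^+ 2 - 2 = (a - b) ^+ 2 by rewrite sqrrB e3; lra.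
lra.
Qed.

Lemma expR_small (y : R) : 0 <= y -> y <= 2^-1 -> expR y <= 1 + 2 * y.
Proof.
move=> y0 y1; have h := @expR_ge1Dx R (- y).
have e : expR y * expR (- y) = 1 :> R by rewrite -expRD subrr expR0.
have := expR_gt0 y; nra.
Qed.

Lemma dotMZl d K (a : R) (A V : 'M[R]_(d, K)) : dotM (a *: A) V = a * dotM A V.
Proof.
rewrite /dotM mulr_sumr; apply: eq_bigr => i _; rewrite mulr_sumr.
by apply: eq_bigr => j _; rewrite mxE mulrA.
Qed.

Lemma frobZ d K (a : R) (A : 'M[R]_(d, K)) : frob (a *: A) = a ^+ 2 * frob A.
Proof.
rewrite /frob mulr_sumr; apply: eq_bigr => i _; rewrite mulr_sumr.
by apply: eq_bigr => j _; rewrite mxE exprMn.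
Qed.

Lemma dotM_delta d K i j (V : 'M[R]_(d, K)) : dotM (delta_mx i j) V = V i j.
Proof.
rewrite /dotM (bigD1 i)//= (bigD1 j)//= mxE !eqxx mul1r.
rewrite [X in _ + X + _]big1 ?[X in _ + X]big1 ?addr0// => k ki.
  rewrite big1// => l _; by rewrite mxE (negbTE ki) mul0r.
by rewrite mxE (negbTE ki) andbF mul0r.
Qed.

Lemma frob_delta d K (i : 'I_d) (j : 'I_K) : frob (delta_mx i j : 'M[R]_(d, K)) = 1.
Proof.
transitivity (dotM (delta_mx i j) (delta_mx i j : 'M[R]_(d, K))).
  by rewrite /frob /dotM; apply: eq_bigr => k _; apply: eq_bigr => l _; rewrite expr2.
by rewrite dotM_delta mxE !eqxx.
Qed.

Let tilt_comb (E x p m y z T : R) : E * p = x * y -> E * m = x * z ->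
  4 * T * (E * (p + m) + -2 * x) = x * (T * (4 * (y + z - 2))).
Proof. by move=> hp hm; rewrite [E * (p + m)]mulrDr hp hm; ring. Qed.

(* Linear and quadratic terms are dominated by exponentials of linear forms,
   which only shift the mean of the Gaussian. *)
Lemma iso_moment_le (t : R) d K (mu A : 'M[R]_(d, K)) (b c : R)
    (f : 'M[R]_(d, K) -> R) r : 0 < t -> 0 <= b -> hasint f r ->
  (forall V, f (mu + V) <= iso t mu (mu + V) * (c + dotM A V + b * frob V)) ->
  r <= c + 1 + 8 * b * t * (d * K)%:R.
Proof.
move=> t0 b0 hf fle.
set k := t * frob A / 2; have k0 : 0 <= k.
  by rewrite divr_ge0// mulr_ge0 ?frob_ge0// ltW.
have k1 : 0 < 2 * k + 1 by rewrite ltr_wpDl// mulr_ge0.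
(* The linear form is at most (exp(a dotM A V) - 1) / a, whose average is (exp(a^2 k) - 1) / a <= 2
   a k. This choice of [a] makes a^2 k at most 1/2 and 2 a k at most 1, however large [A] is. *)
set a := (2 * k + 1)^-1; have a0 : 0 < a by rewrite invr_gt0.
have ak : 2 * (a * k) <= 1.
  by rewrite mulrCA mulrC ler_pdivrMr// mul1r; lra.
have a1 : a <= 1 by rewrite invf_le1//; lra.
(* One over the standard deviation: a tilt by [w] or [- w] along one entry costs exp(1/2), so each
   entry contributes at most 4 t (2 exp(1/2) - 2) <= 8 t. *)
set w := (Num.sqrt t)^-1; have st0 : 0 < Num.sqrt t by rewrite sqrtr_gt0.
have w2 : t * w ^+ 2 = 1.
  by rewrite -[X in X * _](sqr_sqrtr (ltW t0)) /w exprVn divff// expf_neq0// gt_eqF.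
pose q := iso t mu.
pose qa := iso t (mu + t *: (a *: A)).
pose qp i j := iso t (mu + t *: (w *: delta_mx i j)).
pose qm i j := iso t (mu + t *: (- w *: delta_mx i j)).
pose g W := c * q W + (a^-1 * (expR (a ^+ 2 * k) * qa W + (-1) * q W)
  + b * \sum_i \sum_j (4 * t) * (expR (2^-1) * (qp i j W + qm i j W) + (-2) * q W)).
pose s := c * 1 + (a^-1 * (expR (a ^+ 2 * k) * 1 + (-1) * 1)
  + b * \sum_(i < d) \sum_(j < K) (4 * t) * (expR (2^-1) * (1 + 1) + (-2) * 1)).
have hg : hasint g s.
  apply: hasintD; first exact/hasintZ/hasint_iso.
  apply: hasintD.
    by apply: hasintZ; apply: hasintD; apply: hasintZ; exact: hasint_iso.
  apply: hasintZ; apply: hasint_sum => i; apply: hasint_sum => j.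
  apply: hasintZ; apply: hasintD; last exact/hasintZ/hasint_iso.
  by apply: hasintZ; apply: hasintD; exact: hasint_iso.
have fg W : f W <= g W.
  rewrite -[W](subrKC mu); set V := W - mu; apply: (le_trans (fle V)).
  have q0 : 0 < iso t mu (mu + V) by rewrite isoE// expR_gt0.
  rewrite /g -/(q (mu + V)) in q0 *; rewrite mulrDr mulrDr -addrA mulrC lerD2l.
  apply: lerD.
    have <- : q (mu + V) * expR (dotM (a *: A) V) =
        expR (a ^+ 2 * k) * qa (mu + V).
      by rewrite iso_tilt// frobZ; congr (expR _ * _); rewrite /k; ring.
    rewrite dotMZl ler_pdivlMl//.
    by have := ler_wpM2l (ltW q0) (expR_ge1Dx (a * dotM A V)); lra.
  rewrite mulrCA ler_wpM2l// /frob mulr_sumr; apply: ler_sum => i _.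
  rewrite mulr_sumr; apply: ler_sum => j _.
  have eh u : u ^+ 2 = w ^+ 2 -> expR 2^-1 * iso t (mu + t *: (u *: delta_mx i j)) (mu + V) =
      q (mu + V) * expR (u * V i j).
    move=> uw; rewrite -[in RHS](dotM_delta i j V) -dotMZl iso_tilt//.
    by rewrite frobZ frob_delta uw mulr1 w2 mul1r.
  have -> : (4 * t) * (expR 2^-1 * (qp i j (mu + V) + qm i j (mu + V)) + -2 * q (mu + V))
      = q (mu + V) * (t * (4 * (expR (w * V i j) + expR (- w * V i j) - 2))).
    exact: tilt_comb (eh w erefl) (eh (- w) (sqrrN w)).
  rewrite ler_pM2l//.
  have := sqr_le_cosh (w * V i j); rewrite exprMn mulNr => h.
  have : t * (w ^+ 2 * V i j ^+ 2) <=
    t * (4 * (expR (w * V i j) + expR (- (w * V i j)) - 2)) by rewrite ler_pM2l.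
  have -> : t * (w ^+ 2 * V i j ^+ 2) = V i j ^+ 2 by rewrite mulrA w2 mul1r.
  by [].
have := hasint_le fg hf hg => /le_trans; apply.
rewrite /s.
have h1 : a^-1 * (expR (a ^+ 2 * k) * 1 + -1 * 1) <= 1.
  have ak2 : a ^+ 2 * k <= 2^-1.
    rewrite expr2 -mulrA; have := mulr_ge0 (ltW a0) k0; nra.
  have := expR_small (mulr_ge0 (sqr_ge0 a) k0) ak2.
  move=> h; rewrite ler_pdivrMl//.
  have : a * (2 * (a * k)) <= a * 1 by rewrite ler_pM2l.
  rewrite expr2 in h *; lra.
have h2 : \sum_(i < d) \sum_(j < K) (4 * t) * (expR (2^-1) * (1 + 1) + (-2) * 1)
    <= 8 * t * (d * K)%:R.
  under eq_bigr do rewrite sumr_const card_ord.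
  rewrite sumr_const card_ord -mulrnA -[leLHS]mulr_natr mulnC.
  rewrite ler_wpM2r//; have := expR_half_le2 => e2.
  have : t * expR (2^-1) <= t * 2 by rewrite ler_pM2l.
  lra.
have h3 := ler_wpM2l b0 h2.
lra.
Qed.

End gaussian_moments.

(** * Evidence, variational inequality and comparison with the truth *)

Section risk_bound.
Variable R : realType.
Variables sigma2 s alpha : R.
Hypothesis sigma2_gt0 : 0 < sigma2.
Hypothesis s_gt0 : 0 < s.
Hypothesis alpha01 : 0 < alpha < 1.

Local Notation pdf := (ppca_pdf sigma2).
Local Notation llik := (loglik sigma2).
Local Notation prec := (prec sigma2).

Let alpha_gt0 : 0 < alpha. Proof. by case/andP: alpha01. Qed.
Let alpha_lt1 : alpha < 1. Proof. by case/andP: alpha01. Qed.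

Definition geomix d K K0 (W : 'M[R]_(d, K)) (W0 : 'M[R]_(d, K0)) (x : 'rV[R]_d) : R :=
  pdf W x `^ alpha * pdf W0 x `^ (1 - alpha).

Lemma geomixE d K K0 (W : 'M[R]_(d, K)) (W0 : 'M[R]_(d, K0)) x :
  geomix W W0 x = expR (alpha * ln (pdf W x) + (1 - alpha) * ln (pdf W0 x)).
Proof.
have powE (a x' : R) : 0 < a -> a `^ x' = expR (x' * ln a).
  by move=> a0; rewrite mulrC expRM lnK.
rewrite /geomix (powE _ alpha (ppca_pdf_gt0 sigma2_gt0 W x)).
by rewrite (powE _ (1 - alpha) (ppca_pdf_gt0 sigma2_gt0 W0 x)) -expRD.
Qed.

Lemma measurable_geomix e (Z : measurableType e) d K K0 (W0 : 'M[R]_(d, K0))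
    (W : Z -> 'M[R]_(d, K)) (x : Z -> 'rV[R]_d) : mxmeas W -> mxmeas x ->
  measurable_fun setT (fun z => geomix (W z) W0 (x z)).
Proof.
move=> mW mx; under eq_fun do rewrite geomixE.
apply: measurableT_comp => //; apply: measurable_funD; apply: measurable_funM => //.
  by apply: measurableT_comp; [exact: measurable_ln|exact: measurable_ppca_pdf].
apply: measurableT_comp; first exact: measurable_ln.
by apply: (@measurable_ppca_pdf _ _ _ _ _ _ _ (fun=> W0)) => //; exact: mxmeas_cst.
Qed.

(** The integrand is an unnormalised Gaussian whose precision is the convex combination of the two
    precisions. Its integral is finite and positive, so [fine] and [ln] in [renyi] act on a genuine
    value. *)
Lemma intRn_geomix d K K0 (W : 'M[R]_(d, K)) (W0 : 'M[R]_(d, K0)) :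
  exists2 h : R, 0 < h & intRn (fun x => (geomix W W0 x)%:E) = h%:E.
Proof.
pose P := alpha *: prec W + (1 - alpha) *: prec W0.
have pP : posdef P.
  by apply: posdefD; apply: posdefZ; rewrite ?subr_gt0//; exact: prec_posdef.
pose c := alpha * (- (d%:R * ln (2 * pi) + ln (\det (ppca_cov sigma2 W))) / 2) +
  (1 - alpha) * (- (d%:R * ln (2 * pi) + ln (\det (ppca_cov sigma2 W0))) / 2).
exists (expR c * expR ((d%:R * ln (2 * pi) - ln (\det P)) / 2)).
  by rewrite mulr_gt0// expR_gt0.
rewrite EFinM -(intRn_gauss 0 pP) -ge0_intRnZ; first 1 last.
- exact: vmeas_expR_qf.
- by move=> v; rewrite lee_fin expR_ge0.
- exact: expR_ge0.
apply: eq_intRn => x; rewrite geomixE -EFinM -expRD; congr (expR _)%:E.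
rewrite !ln_ppca_pdf// subr0.
have -> : qf P x = alpha * qf (prec W) x + (1 - alpha) * qf (prec W0) x.
  by rewrite /qf mulmxDr mulmxDl mxE -!scalemxAr -!scalemxAl mxE [X in _ + X]mxE.
by rewrite /c; lra.
Qed.

Lemma renyi_geomix d K K0 (W : 'M[R]_(d, K)) (W0 : 'M[R]_(d, K0)) h :
  intRn (fun x => (geomix W W0 x)%:E) = h%:E ->
  (1 - alpha) * renyi alpha (pdf W) (pdf W0) = - ln h.
Proof.
rewrite /renyi -/(geomix W W0) => ->/=.
by field; rewrite subr_eq0 lt_eqF.
Qed.

Lemma measurable_renyi e (Z : measurableType e) d K K0 (W0 : 'M[R]_(d, K0))
    (W : Z -> 'M[R]_(d, K)) : mxmeas W ->
  measurable_fun setT (fun z => renyi alpha (pdf (W z)) (pdf W0)).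
Proof.
move=> mW; apply: measurable_funM => //.
apply: measurableT_comp; first exact: measurable_ln.
apply: measurableT_comp; first exact: fine_measurable.
apply: (@measurable_intRn _ _ _ _ (fun z x => (geomix (W z) W0 x)%:E)).
move=> e' Z' h g mh mg; apply/measurable_EFinP.
apply: (@measurable_geomix _ _ _ _ _ _ (W \o h)) => //.
by move=> i j; exact: (measurableT_comp (mW i j) mh).
Qed.

(* [devi] is the function g and [evid] the integral Z_K of the introduction. *)
Definition devi n d K K0 (W0 : 'M[R]_(d, K0)) (X : 'M[R]_(n, d)) (W : 'M[R]_(d, K)) : R :=
  alpha * (llik X W - llik X W0) + n%:R * ((1 - alpha) * renyi alpha (pdf W) (pdf W0)).

Definition lhd n d K0 (W0 : 'M[R]_(d, K0)) (X : 'M[R]_(n, d)) : R :=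
  \prod_(i < n) pdf W0 (row i X).

Lemma lhd_gt0 n d K0 (W0 : 'M[R]_(d, K0)) (X : 'M[R]_(n, d)) : 0 < lhd W0 X.
Proof. by apply: prodr_gt0 => i _; exact: ppca_pdf_gt0. Qed.

Lemma lhdE n d K0 (W0 : 'M[R]_(d, K0)) (X : 'M[R]_(n, d)) : lhd W0 X = expR (llik X W0).
Proof.
rewrite /llik expR_sum; apply: eq_bigr => i _.
by rewrite lnK// posrE; exact: ppca_pdf_gt0.
Qed.

Lemma measurable_lhd e (Z : measurableType e) n d K0 (W0 : 'M[R]_(d, K0))
    (X : Z -> 'M[R]_(n, d)) : mxmeas X ->
  measurable_fun setT (fun z => lhd W0 (X z)).
Proof.
move=> mX; apply: measurable_prod => i _.
apply: (@measurable_ppca_pdf _ _ _ _ _ _ _ (fun=> W0)) => //.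
exact: mxmeas_row.
Qed.

Lemma measurable_devi e (Z : measurableType e) n d K K0 (W0 : 'M[R]_(d, K0))
    (X : Z -> 'M[R]_(n, d)) (W : Z -> 'M[R]_(d, K)) : mxmeas X -> mxmeas W ->
  measurable_fun setT (fun z => devi W0 (X z) (W z)).
Proof.
move=> mX mW; apply: measurable_funD.
  apply: measurable_funM => //; apply: measurable_funB.
    exact: measurable_loglik.
  by apply: (@measurable_loglik _ _ _ _ _ _ _ _ (fun=> W0)) => //; exact: mxmeas_cst.
apply: measurable_funM => //; apply: measurable_funM => //; exact: measurable_renyi.
Qed.

Lemma prior_pdfE d K (W : 'M[R]_(d, K)) : prior_pdf s W = iso (s ^+ 2) 0 W.
Proof.
rewrite /prior_pdf /iso /mf_pdf; apply: eq_bigr => j _.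
by rewrite linear0 trmx0.
Qed.

Let s2_gt0 : 0 < s ^+ 2. Proof. by rewrite exprn_gt0. Qed.

Lemma prior_pdf_gt0 d K (W : 'M[R]_(d, K)) : 0 < prior_pdf s W.
Proof. by rewrite prior_pdfE isoE// expR_gt0. Qed.

Lemma measurable_prior e (Z : measurableType e) d K (W : Z -> 'M[R]_(d, K)) :
  mxmeas W -> measurable_fun setT (fun z => prior_pdf s (W z)).
Proof.
move=> mW; under eq_fun do rewrite prior_pdfE.
by apply: measurable_mf_pdf => // j; exact: posdef_scalar.
Qed.

Definition evid n d K K0 (W0 : 'M[R]_(d, K0)) (X : 'M[R]_(n, d)) : \bar R :=
  intM (fun W : 'M[R]_(d, K) => (prior_pdf s W * expR (devi W0 X W))%:E).

Lemma evid_ge0 n d K K0 (W0 : 'M[R]_(d, K0)) (X : 'M[R]_(n, d)) :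
  (0 <= evid K W0 X)%E.
Proof.
by apply: intM_ge0 => W; rewrite lee_fin mulr_ge0 ?expR_ge0// ltW// prior_pdf_gt0.
Qed.

Lemma mmeas2_evid n d K K0 (W0 : 'M[R]_(d, K0)) :
  mmeas2 (fun (X : 'M[R]_(n, d)) (W : 'M[R]_(d, K)) =>
    (prior_pdf s W * expR (devi W0 X W))%:E).
Proof.
move=> e Z g h mg mh; apply/measurable_EFinP; apply: measurable_funM.
  exact: measurable_prior.
by apply: measurableT_comp => //; exact: measurable_devi.
Qed.

Lemma mmeas_evid n d K K0 (W0 : 'M[R]_(d, K0)) : mmeas (@evid n d K K0 W0).
Proof. by move=> e Z g mg; exact: (measurable_intM (@mmeas2_evid n d K K0 W0) mg). Qed.

(* Under the model P_{W0}, the exponentiated deviation has expectation one for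
   every W, by definition of the Renyi divergence. *)
Lemma expectation_evid n d K K0 (W0 : 'M[R]_(d, K0)) :
  intM (fun X : 'M[R]_(n, d) => (lhd W0 X)%:E * evid K W0 X)%E = 1%E.
Proof.
transitivity (intM (fun X : 'M[R]_(n, d) => intM (fun W : 'M[R]_(d, K) =>
   (lhd W0 X * (prior_pdf s W * expR (devi W0 X W)))%:E))).
  apply: eq_intM => X; rewrite -ge0_intMZ.
  - by [].
  - by move=> e Z g mg; exact: (@mmeas2_evid n d K K0 W0 e Z (fun=> X) g (mxmeas_cst X) mg).
  - by move=> W; rewrite lee_fin mulr_ge0 ?expR_ge0// ltW// prior_pdf_gt0.
  - exact/ltW/lhd_gt0.
rewrite intM_swap; first 1 last.
- move=> e Z g h mg mh; apply/measurable_EFinP; apply: measurable_funM.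
    exact: measurable_lhd.
  by apply/measurable_EFinP; exact: mmeas2_evid.
- move=> X W; rewrite lee_fin mulr_ge0 ?mulr_ge0 ?expR_ge0//; apply: ltW.
    exact: lhd_gt0.
  exact: prior_pdf_gt0.
transitivity (intM (fun W : 'M[R]_(d, K) => (iso (s ^+ 2) 0 W)%:E)); last first.
  by have [_] := hasint_iso (0 : 'M[R]_(d, K)) s2_gt0.
apply: eq_intM => W; have [h h0 hE] := intRn_geomix W W0.
(* The likelihood times the likelihood ratio to the power alpha is a product of [geomix] over the
   sample; its integral h^n cancels exp(- n ln h). *)
transitivity (intM (fun X : 'M[R]_(n, d) =>
  (prior_pdf s W * expR (- (n%:R * ln h)))%:E * (\prod_i geomix W W0 (row i X))%:E)%E).
  apply: eq_intM => X; rewrite -EFinM; congr (_%:E).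
  rewrite mulrCA -mulrA; congr (_ * _).
  rewrite lhdE /devi (renyi_geomix hE).
  under eq_bigr do rewrite geomixE.
  rewrite -expR_sum -!expRD; congr expR.
  have -> : \sum_(i < n) (alpha * ln (pdf W (row i X)) + (1 - alpha) * ln (pdf W0 (row i X)))
      = alpha * llik X W + (1 - alpha) * llik X W0.
    by rewrite /loglik !mulr_sumr -big_split.
  move: (llik X W) (llik X W0) (ln h) (n%:R : R) => a b c m; ring.
rewrite ge0_intMZ; first 1 last.
- move=> e Z g mg; apply/measurable_EFinP; apply: measurable_prod => i _.
  apply: (@measurable_geomix _ _ _ _ _ _ (fun=> W)); first exact: mxmeas_cst.
  exact: mxmeas_row.
- by move=> X; rewrite lee_fin; apply: prodr_ge0 => i _; rewrite geomixE expR_ge0.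
- by rewrite mulr_ge0 ?expR_ge0// ltW// prior_pdf_gt0.
rewrite (@intM_prod_rows _ _ _ (fun=> geomix W W0) (fun=> h))//.
- rewrite prodr_const card_ord -EFinM -mulrA -{2}(lnK (h0 : h \is Num.pos)).
  by rewrite -expRM_natl -expRD addNr expR0 mulr1 prior_pdfE.
- move=> i e Z g mg; apply/measurable_EFinP.
  by apply: (@measurable_geomix _ _ _ _ _ _ (fun=> W)) => //; exact: mxmeas_cst.
- by move=> i v; rewrite geomixE expR_ge0.
Qed.

(** Both integrands are a Gaussian density times a function of at most quadratic growth. The
    objective is therefore real at every parameter, and so is an attained ELBO. *)
Lemma vobj_hasint n d K (X : 'M[R]_(n, d)) (mu : 'M[R]_(d, K)) (S : 'I_K -> 'M[R]_d) :
  (forall j, posdef (S j)) ->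
  exists r1 r2 : R, [/\ hasint (fun W => llik X W * mf_pdf mu S W) r1,
    hasint (fun W => mf_pdf mu S W * ln (mf_pdf mu S W / prior_pdf s W)) r2 &
    vobj sigma2 s alpha X mu S = (alpha * r1 - r2)%:E].
Proof.
move=> pS.
have [A [B [B0 hAB]]] := loglik_bound sigma2_gt0 K X.
have [r1 h1] : exists r, hasint (fun W => llik X W * mf_pdf mu S W) r.
  apply: gdom_hasint; apply: (@gdom_mf_pdf _ _ _ mu S (fun W => llik X W) A B) => // e Z g mg.
  by apply: measurable_loglik => //; exact: mxmeas_cst.
have pT (j : 'I_K) : posdef ((s ^+ 2)%:M : 'M[R]_d) by exact: posdef_scalar.
have [A1 [B1 [B10 hAB1]]] := ln_mf_pdf_bound mu pS.
have [A2 [B2 [B20 hAB2]]] := ln_mf_pdf_bound 0 pT.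
have lnE W : ln (mf_pdf mu S W / prior_pdf s W) =
    ln (mf_pdf mu S W) - ln (mf_pdf 0 (fun=> (s ^+ 2)%:M) W).
  rewrite ln_div ?posrE; [|exact: mf_pdf_gt0|exact: prior_pdf_gt0].
  by rewrite prior_pdfE.
have [r2 h2] : exists r,
    hasint (fun W => mf_pdf mu S W * ln (mf_pdf mu S W / prior_pdf s W)) r.
  apply: gdom_hasint; under eq_fun do rewrite mulrC lnE.
  apply: (@gdom_mf_pdf _ _ _ mu S (fun W => ln (mf_pdf mu S W)
    - ln (mf_pdf 0 (fun=> (s ^+ 2)%:M) W)) (A1 + A2) (B1 + B2)) => //.
  - move=> e Z g mg; apply: measurable_funB; apply: measurableT_comp;
      try exact: measurable_ln; exact: measurable_mf_pdf.
  - exact: addr_ge0.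
  - move=> W; apply: (le_trans (ler_normB _ _)).
    by rewrite mulrDl addrACA; apply: lerD; [exact: hAB1|exact: hAB2].
exists r1, r2; split => //.
by rewrite /vobj /KLdens (proj2 h1) (proj2 h2).
Qed.

(** The pointwise form of the Donsker-Varadhan inequality. The free scale [c] stands in for the
    normalising constant, at the price ln c. *)
Let young (q p g c : R) : 0 < q -> 0 < p -> 0 < c ->
  q * g <= q * ln (q / p) + c^-1 * (p * expR g) + ln c * q.
Proof.
move=> q0 p0 c0.
have y0 : 0 < p * expR g / (q * c) by rewrite divr_gt0 ?mulr_gt0// expR_gt0.
have h : ln (p * expR g / (q * c)) <= p * expR g / (q * c) - 1.
  have := expR_ge1Dx (ln (p * expR g / (q * c))).
  by rewrite lnK ?posrE//; lra.
have e : ln (p * expR g / (q * c)) = ln p + g - (ln q + ln c).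
  rewrite ln_div ?posrE ?mulr_gt0 ?expR_gt0// [ln (p * _)]lnM ?posrE ?expR_gt0//.
  by rewrite [ln (q * c)]lnM ?posrE// expRK.
rewrite ln_div ?posrE//; rewrite e in h.
have := ler_wpM2l (ltW q0) h.
have -> : q * (p * expR g / (q * c) - 1) = c^-1 * (p * expR g) - q.
  by field; rewrite !gt_eqF.
lra.
Qed.

Lemma variational_bound n d K K0 (W0 : 'M[R]_(d, K0)) (X : 'M[R]_(n, d))
    (mu : 'M[R]_(d, K)) (S : 'I_K -> 'M[R]_d) (v : R) :
  (0 < n)%N -> (0 < d)%N -> (forall j, posdef (S j)) ->
  vobj sigma2 s alpha X mu S = v%:E ->
  (intM (fun W => (renyi alpha (pdf W) (pdf W0) * mf_pdf mu S W)%:E) <=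
   ((n%:R * (1 - alpha))^-1 * (alpha * llik X W0 - v + ln d%:R))%:E
   + ((n%:R * (1 - alpha))^-1 / d%:R)%:E * evid K W0 X)%E.
Proof.
move=> n0 d0 pS vE; have [r1 [r2 [h1 h2 vE']]] := vobj_hasint X mu pS.
have vr : v = alpha * r1 - r2 by apply/EFin_inj; rewrite -vE -vE'.
set k := (n%:R * (1 - alpha))^-1.
have nr0 : 0 < n%:R :> R by rewrite ltr0n.
have dr0 : 0 < d%:R :> R by rewrite ltr0n.
have nk0 : 0 < n%:R * (1 - alpha) by rewrite mulr_gt0// subr_gt0.
have k0 : 0 < k by rewrite invr_gt0.
(* The part of the bound with a finite signed integral; the evidence is kept apart as a nonnegative
   term that may integrate to infinity. *)
pose f W := k * (alpha * llik X W0 * mf_pdf mu S W + (- alpha *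
   (llik X W * mf_pdf mu S W) + (mf_pdf mu S W * ln (mf_pdf mu S W / prior_pdf s W)
   + ln d%:R * mf_pdf mu S W))).
have hq := hasint_mf_pdf mu pS.
have hf : hasint f (k * (alpha * llik X W0 * 1 + (- alpha * r1 + (r2 + ln d%:R * 1)))).
  apply: hasintZ; apply: hasintD; first exact: hasintZ.
  apply: hasintD; first exact: hasintZ.
  by apply: hasintD => //; exact: hasintZ.
have -> : k * (alpha * llik X W0 - v + ln d%:R) =
  k * (alpha * llik X W0 * 1 + (- alpha * r1 + (r2 + ln d%:R * 1))).
  by rewrite vr; ring.
rewrite -(proj2 hf).
have kd0 : 0 <= k / d%:R by rewrite divr_ge0// ltW.
rewrite -ge0_intMZ//; first 1 last.
- by move=> e Z g mg; exact: (@mmeas2_evid n d K K0 W0 e Z (fun=> X) g (mxmeas_cst X) mg).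
- by move=> W; rewrite lee_fin mulr_ge0 ?expR_ge0// ltW// prior_pdf_gt0.
apply: (@le_trans _ _ (intM (fun W => (f W)%:E +
   (k / d%:R)%:E * (prior_pdf s W * expR (devi W0 X W))%:E)%E)).
  apply: le_intM => W; rewrite -EFinM -EFinD lee_fin.
  have q0 : 0 < mf_pdf mu S W by exact: mf_pdf_gt0.
  have := young (devi W0 X W) q0 (prior_pdf_gt0 W) dr0.
  rewrite /f; set D := renyi _ _ _; set q := mf_pdf mu S W.
  set L := ln (q / _); set E := prior_pdf s W * _.
  move=> h.
  have -> : D * q = k * (q * (n%:R * ((1 - alpha) * D))).
    by rewrite /k; field; rewrite subr_eq0 !gt_eqF.
  have -> : k / d%:R * E = k * (d%:R^-1 * E) by rewrite mulrA.
  rewrite -mulrDr ler_pM2l//.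
  move: h; rewrite /devi -/D.
  move: (llik X W) (llik X W0) (n%:R * _) (d%:R^-1 * E) (ln d%:R) q L => x1 x2 x3 x4 x5 x6 x7.
  clear; move=> h; lra.
apply: (@intRn_le_gdomD _ _ (fun v => f (vec_mx v))
  (fun v => (k / d%:R)%:E * (prior_pdf s (vec_mx v) * expR (devi W0 X (vec_mx v)))%:E)%E).
- exact: (proj1 hf).
- move=> e Z g mg; apply: emeasurable_funM => //.
  exact: (@mmeas2_evid n d K K0 W0 e Z (fun=> X) _ (mxmeas_cst X) (mxmeas_vec_mx mg)).
- move=> w; rewrite -EFinM lee_fin mulr_ge0// mulr_ge0 ?expR_ge0//.
  exact/ltW/prior_pdf_gt0.
Qed.

Lemma frobD_le d K (V W : 'M[R]_(d, K)) : frob (W + V) <= 2 * frob W + 2 * frob V.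
Proof.
rewrite /frob !mulr_sumr -big_split/=; apply: ler_sum => i _.
rewrite !mulr_sumr -big_split/=; apply: ler_sum => j _; rewrite !mxE.
by have := sqr_ge0 (W i j - V i j); nra.
Qed.

(** The exponent of [iso t] is negative and is dropped. The normalising constants give half of
    ln(s^2 / t) per entry, and the prior exponent is split by |W0 + V|^2 <= 2 |W0|^2 + 2 |V|^2. *)
Lemma ln_iso_prior_le d K (W0 V : 'M[R]_(d, K)) (C t : R) :
  (forall i j, `|W0 i j| <= C) -> 0 < t ->
  ln (iso t W0 (W0 + V) / prior_pdf s (W0 + V)) <=
   (d * K)%:R * ((ln (s ^+ 2) - ln t) / 2 + C ^+ 2 / s ^+ 2) + (s ^+ 2)^-1 * frob V.
Proof.
move=> WC t0; rewrite ln_div ?posrE ?prior_pdf_gt0//; last by rewrite isoE// expR_gt0.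
rewrite prior_pdfE !isoE// !expRK subr0 [W0 + V - W0]addrC addKr.
have fV := frob_ge0 V; have fW := frob_le_bounded WC; have fWV := frobD_le V W0.
have g1 : 0 <= frob V / (2 * t) by rewrite divr_ge0// mulr_ge0// ltW.
have g2 : frob (W0 + V) / (2 * s ^+ 2) <=
    (s ^+ 2)^-1 * ((d * K)%:R * C ^+ 2 + frob V).
  rewrite ler_pdivrMr ?mulr_gt0//.
  have -> : (s ^+ 2)^-1 * ((d * K)%:R * C ^+ 2 + frob V) * (2 * s ^+ 2) =
    2 * ((d * K)%:R * C ^+ 2) + 2 * frob V by field; rewrite gt_eqF.
  apply: (le_trans fWV); rewrite lerD2r ler_pM2l//.
rewrite mulrDr in g2.
move: (frob (W0 + V) / (2 * s ^+ 2)) (frob V / (2 * t)) ((s ^+ 2)^-1) (ln (s ^+ 2)) (ln t)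
  (ln (2 * pi)) ((d * K)%:R : R) (frob V) (C ^+ 2) g1 g2 => a b si ls lt lp dk fv C2.
clear; move=> g1 g2; lra.
Qed.

(** The variance [t] is left free, and the sample appears on the right only through the sum of its
    Mahalanobis forms. *)
Lemma vobj_truth n d K0 (W0 : 'M[R]_(d, K0)) (X : 'M[R]_(n, d)) (C t : R) :
  (forall i j, `|W0 i j| <= C) -> 0 < t ->
  exists v : R, vobj sigma2 s alpha X W0 (fun=> t%:M) = v%:E /\
  alpha * llik X W0 - v <=
    (d * K0)%:R * ((ln (s ^+ 2) - ln t) / 2 + C ^+ 2 / s ^+ 2) + 1 +
    8 * (alpha * ((n%:R + \sum_i qf (prec W0) (row i X)) / (2 * sigma2)) + (s ^+ 2)^-1)
      * t * (d * K0)%:R.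
Proof.
move=> WC t0; have pS (j : 'I_K0) : posdef (t%:M : 'M[R]_d) by exact: posdef_scalar.
have [r1 [r2 [h1 h2 vE]]] := vobj_hasint X W0 pS.
exists (alpha * r1 - r2); split => //.
have [A hA] := loglik_perturb sigma2_gt0 X W0.
pose f W := alpha * llik X W0 * iso t W0 W + (- alpha * (llik X W * iso t W0 W)
  + iso t W0 W * ln (iso t W0 W / prior_pdf s W)).
have hf : hasint f (alpha * llik X W0 * 1 + (- alpha * r1 + r2)).
  apply: hasintD; first exact/hasintZ/hasint_iso.
  by apply: hasintD => //; exact: hasintZ.
have -> : alpha * llik X W0 - (alpha * r1 - r2) =
  alpha * llik X W0 * 1 + (- alpha * r1 + r2) by ring.
have qs0 : 0 <= \sum_i qf (prec W0) (row i X).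
  by apply: sumr_ge0 => i _; apply: posdef_qf_ge0; exact: prec_posdef.
have si0 : 0 < (s ^+ 2)^-1 by rewrite invr_gt0.
apply: (@iso_moment_le _ t _ _ W0 (alpha *: A) _ _ f) => //.
  rewrite addr_ge0 ?(ltW si0)// mulr_ge0 ?(ltW alpha_gt0)// divr_ge0 ?addr_ge0//.
  by rewrite mulr_ge0// ltW.
move=> V; rewrite /f.
have q0 : 0 < iso t W0 (W0 + V) by rewrite isoE// expR_gt0.
have := hA V; set Q := (n%:R + _) / _ => hl.
have hln := ln_iso_prior_le V WC t0.
have hl' : alpha * (llik X W0 - llik X (W0 + V)) <= alpha * (dotM A V + Q * frob V).
  by rewrite ler_wpM2l// ltW.
rewrite dotMZl.
have -> : forall x y z w : R, x * w + (- alpha * (y * w) + w * z) =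
  w * (x - alpha * y + z) by move=> *; ring.
rewrite ler_pM2l//.
clear hl.
move: (llik X (W0 + V)) (llik X W0) (ln (_ / _)) (dotM A V) Q (frob V)
  (s ^+ 2)^-1 hln hl' => x1 x2 x3 x4 x5 x6 x7; clear; move=> h1 h2; lra.
Qed.

End risk_bound.

(** * Exponential moments of the Mahalanobis forms *)

Section expectation_bounds.
Variable R : realType.
Variable sigma2 : R.
Hypothesis sigma2_gt0 : 0 < sigma2.

Lemma oppr_ln1B_le (y : R) : 0 <= y -> y <= 2^-1 -> - ln (1 - y) <= 2 * y.
Proof.
(* For y in [0, 1/2], (1 - y) exp(2 y) >= (1 - y) (1 + 2 y) >= 1. *)
move=> y0 y1; have e := @expR_ge1Dx R (2 * y).
have : 0 <= ln ((1 - y) * expR (2 * y)).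
  by apply: ln_ge0; nra.
by rewrite lnM ?posrE ?expR_gt0 ?expRK; lra.
Qed.

Definition tilted n d K (W0 : 'M[R]_(d, K)) (x : 'rV[R]_d) : R :=
  ppca_pdf sigma2 W0 x * expR (qf (prec sigma2 W0) x / (4 * (n * d)%:R)).

Lemma tilted_ge0 n d K (W0 : 'M[R]_(d, K)) x : 0 <= tilted n W0 x.
Proof. by rewrite mulr_ge0 ?expR_ge0// ltW//; exact: ppca_pdf_gt0. Qed.

Lemma measurable_tilted e (Z : measurableType e) n d K (W0 : 'M[R]_(d, K))
    (g : Z -> 'rV[R]_d) : mxmeas g ->
  measurable_fun setT (fun z => tilted n W0 (g z)).
Proof.
move=> mg; apply: measurable_funM.
  by apply: (@measurable_ppca_pdf _ _ _ _ _ _ _ (fun=> W0)) => //; exact: mxmeas_cst.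
apply: measurableT_comp => //; apply: measurable_funM => //.
by apply: (@measurable_qf _ _ _ _ (fun=> prec sigma2 W0)) => //; exact: mxmeas_cst.
Qed.

Lemma intM_prod_tilted n d K (W0 : 'M[R]_(d, K)) : (0 < n)%N -> (0 < d)%N ->
  (intM (fun X : 'M[R]_(n, d) => (\prod_i tilted n W0 (row i X))%:E) <= 2%:E)%E.
Proof.
(* Tilting multiplies the precision by 1 - y. Each observation contributes (1 - y)^(- d / 2) <=
   exp(d y), and n d y = 1/2, so the product is at most exp(1/2) <= 2. *)
move=> n0 d0; set y := (2 * (n * d)%:R)^-1 : R.
have nd1 : 1 <= (n * d)%:R :> R by rewrite ler1n muln_gt0 n0.
have nd0 : 0 < (n * d)%:R :> R by lra.
have y0 : 0 <= y by rewrite invr_ge0; lra.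
have y1 : y <= 2^-1 by rewrite lef_pV2 ?posrE; lra.
have yT : 0 < 1 - y by lra.
have p0 := prec_posdef sigma2_gt0 W0.
have dS := posdef_det_gt0 (ppca_cov_posdef sigma2_gt0 W0).
have E1 : intRn (fun x => (tilted n W0 x)%:E) = (expR (d%:R * (- ln (1 - y)) / 2))%:E.
  set c := - (d%:R * ln (2 * pi) + ln (\det (ppca_cov sigma2 W0))) / 2.
  transitivity (intRn (fun x : 'rV[R]_d => (expR c)%:E *
     (expR (- qf ((1 - y) *: prec sigma2 W0) (x - 0) / 2))%:E)%E).
    apply: eq_intRn => x; rewrite -EFinM -expRD subr0 /tilted.
    rewrite -{1}(lnK (ppca_pdf_gt0 sigma2_gt0 W0 x : _ \is Num.pos)) -expRD.
    rewrite ln_ppca_pdf// -/c.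
    have -> : qf ((1 - y) *: prec sigma2 W0) x = (1 - y) * qf (prec sigma2 W0) x.
      by rewrite /qf -scalemxAr -scalemxAl mxE.
    congr (expR _)%:E; rewrite /y.
    by move: (qf _ _) ((n * d)%:R : R) nd0 => z m m0; field; rewrite gt_eqF.
  rewrite ge0_intRnZ; first 1 last.
  - exact: vmeas_expR_qf.
  - by move=> v; rewrite lee_fin expR_ge0.
  - exact: expR_ge0.
  rewrite intRn_gauss; last exact: posdefZ.
  have -> : ln (\det ((1 - y) *: prec sigma2 W0)) =
      d%:R * ln (1 - y) - ln (\det (ppca_cov sigma2 W0)).
    rewrite detZ lnM ?posrE ?exprn_gt0 ?posdef_det_gt0// /prec det_inv.
    by rewrite lnV ?posrE// lnXn// mulr_natl.
  rewrite -EFinM -expRD /c; congr (expR _)%:E; lra.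
rewrite (@intM_prod_rows _ _ _ (fun=> tilted n W0)
  (fun=> expR (d%:R * (- ln (1 - y)) / 2))); first 1 last.
- by move=> i e Z g mg; apply/measurable_EFinP; exact: measurable_tilted.
- by move=> i v; exact: tilted_ge0.
- by [].
rewrite prodr_const card_ord -expRM_natl lee_fin.
apply: le_trans (expR_half_le2 R); rewrite ler_expR.
have h := oppr_ln1B_le y0 y1.
have : (n * d)%:R * (- ln (1 - y)) <= (n * d)%:R * (2 * y) by rewrite ler_pM2l.
have -> : (n * d)%:R * (2 * y) = 1.
  by rewrite /y; move: ((n * d)%:R : R) nd0 => m m0; field; rewrite gt_eqF.
rewrite natrM; lra.
Qed.

(** An instance of x <= c exp(x / c): the sum becomes a product, which factorises over the
    observations. The scale c = 4 n d is of the order of the mean n d of the sum, so only a constant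
    is lost. *)
Lemma sum_qf_le n d K (W0 : 'M[R]_(d, K)) (X : 'M[R]_(n, d)) :
  (0 < n)%N -> (0 < d)%N ->
  \sum_i qf (prec sigma2 W0) (row i X) <= 4 * (n * d)%:R *
    \prod_i expR (qf (prec sigma2 W0) (row i X) / (4 * (n * d)%:R)).
Proof.
move=> n0 d0; rewrite -expR_sum -mulr_suml.
have nd0 : 0 < (n * d)%:R :> R by rewrite ltr0n muln_gt0 n0.
set q := \sum_i _; have := expR_ge1Dx (q / (4 * (n * d)%:R)) => h.
rewrite -ler_pdivrMl ?mulr_gt0// mulrC.
apply: le_trans h; by rewrite lerDr.
Qed.

End expectation_bounds.

(** * Arithmetic of the constants *)

Section arithmetic.
Variable R : realType.

(** The coefficient 3/2 collects half of the entropy logarithm and the price ln d of selection.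
    Terms without a logarithm are absorbed by L >= ln 2, whence the division; 36 is 4 + 32, from the
    deterministic and the random part of the quadratic loss. *)
Lemma risk_constant_le (A c c8 S al nr dr dk L lnd : R) :
  0 <= A -> 0 <= c -> 0 <= c8 -> 0 < S -> 0 < al -> 1 <= nr -> 1 <= dr -> 1 <= dk ->
  ln 2 <= L -> lnd <= L ->
  dk * ((A + L) / 2 + c) + 1 + 8 * (al * (nr / (2 * S)) + c8) * (nr * dr)^-1 * dk + lnd
  + 2 * (8 * (al * (4 * (nr * dr) / (2 * S))) * (nr * dr)^-1 * dk) + 1
  <= (3 / 2 + (A / 2 + c + 36 * (al / S) + 8 * c8 + 2) / ln 2) * (dk * L).
Proof.
move=> A0 c0 c80 S0 al0 nr1 dr1 dk1 L2 lndL.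
have l20 : 0 < ln 2 :> R by rewrite ln_gt0// ltr1n.
have nr0 : 0 < nr by lra.
have dr0 : 0 < dr by lra.
have dk0 : 0 < dk by lra.
have L0 : 0 < L by lra.
have aS0 : 0 < al / S by rewrite divr_gt0.
set B := A / 2 + c + 36 * (al / S) + 8 * c8 + 2.
have B0 : 0 <= B by rewrite /B; lra.
have h1 : 8 * (al * (nr / (2 * S)) + c8) * (nr * dr)^-1 * dk <=
    (4 * (al / S) + 8 * c8) * dk.
  rewrite ler_pM2r//.
  have -> : 8 * (al * (nr / (2 * S)) + c8) * (nr * dr)^-1 =
     4 * (al / S) * dr^-1 + 8 * c8 * (nr * dr)^-1.
    by field; rewrite !gt_eqF.
  apply: lerD; rewrite ler_piMr ?invf_le1 ?mulr_gt0//; nra.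
have h2 : 2 * (8 * (al * (4 * (nr * dr) / (2 * S))) * (nr * dr)^-1 * dk) =
    32 * (al / S) * dk.
  by field; rewrite !gt_eqF.
have h3 : B <= B / ln 2 * L.
  by rewrite mulrAC ler_pdivlMr// ler_wpM2l.
have h4 : dk * B <= dk * (B / ln 2 * L) by rewrite ler_pM2l.
have h5 : L <= dk * L by rewrite ler_peMl// ltW.
have -> : (3 / 2 + B / ln 2) * (dk * L) = 3 / 2 * (dk * L) + dk * (B / ln 2 * L) by ring.
rewrite h2; apply: (@le_trans _ _ (3 / 2 * (dk * L) + dk * B)); last by rewrite lerD2l.
rewrite /B; clear h3 h4 h2 B0; clearbody B; lra.
Qed.

Lemma truth_arith (q e t dk u c c8 A L ls nr dr al : R) :
  8 * (al * u) * (t * dk) * q <= 8 * (al * u) * (t * dk) * (4 * (nr * dr) * e) ->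
  dk * ls <= dk * A ->
  dk * ((ls + L) / 2 + c) + 1 + 8 * (al * ((nr + q) * u) + c8) * t * dk <=
  dk * ((A + L) / 2 + c) + 1 + 8 * (al * (nr * u) + c8) * t * dk +
  8 * (al * (4 * (nr * dr) * u)) * t * dk * e.
Proof. by lra. Qed.

Lemma weight_arith (l e x g1 g2 k : R) :
  l * (k * (g1 + g2 * e + x)) <= k * (g1 + x) * l + k * g2 * (l * e).
Proof. by lra. Qed.

End arithmetic.

(** * Model selection and the final risk bound *)

Lemma elbo_comparison (R : realType) (sigma2 s alpha : R) n d K0 K
    (W0 : 'M[R]_(d, K0)) (X : 'M[R]_(n, d)) (t : R) (mu : 'M[R]_(d, K))
    (S : 'I_K -> 'M[R]_d) (mu0 : 'M[R]_(d, K0)) (S0 : 'I_K0 -> 'M[R]_d) (v v0 : R) :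
  0 < sigma2 -> 0 < s -> 0 < t -> (forall j, posdef (S0 j)) ->
  vobj sigma2 s alpha X mu0 S0 = ELBO sigma2 s alpha K0 X ->
  vobj sigma2 s alpha X W0 (fun=> t%:M) = v0%:E ->
  vobj sigma2 s alpha X mu S = v%:E ->
  vobj sigma2 s alpha X mu S = ELBO sigma2 s alpha K X ->
  (ELBO sigma2 s alpha K0 X - (ln (d%:R))%:E <=
   ELBO sigma2 s alpha K X - (ln (d%:R))%:E)%E ->
  v0 <= v.
Proof.
move=> sg0 s0 t0 pS0 E0 v0E vE EK.
(* The maximum for [K0] is attained at a real value, so the chain v0 <= ELBO(K0) <= ELBO(K) = v
   lives in the reals and the equal penalties cancel. *)
have [r1 [r2 [_ _ e]]] := vobj_hasint alpha sg0 s0 X mu0 pS0.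
have : (v0%:E <= ELBO sigma2 s alpha K0 X)%E.
  apply: ereal_sup_ubound; exists W0, (fun=> t%:M); split => [j|//].
  exact: posdef_scalar.
rewrite -E0 -EK vE e -!EFinB !lee_fin; lra.
Qed.

(** [M] is chosen before [d], [K0], [n] and [W0], so the bound is uniform in all of them; [2 <= n]
    keeps ln(d n) above ln 2. *)
Theorem theorem5 (R : realType) (sigma2 s alpha C : R) :
  0 < sigma2 -> 0 < s -> 0 < alpha < 1 ->
  exists M : R, 0 < M /\
  forall (d K0 n : nat) (W0 : 'M[R]_(d, K0)),
    (1 <= d)%N -> (1 <= K0 <= d)%N -> (2 <= n)%N ->
    (forall i j, `|W0 i j| <= C) ->
    forall (rho_mu : forall K : nat, 'M[R]_(n, d) -> 'M[R]_(d, K))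
           (rho_S : forall K : nat, 'M[R]_(n, d) -> 'I_K -> 'M[R]_d)
           (Khat : 'M[R]_(n, d) -> nat),
    (* rho_K(X) = (rho_mu K X, rho_S K X) is a maximiser of the ELBO over F_K *)
    (forall K X, (1 <= K <= d)%N ->
       (forall j, posdef (rho_S K X j)) /\
       vobj sigma2 s alpha X (rho_mu K X) (rho_S K X) = ELBO sigma2 s alpha K X) ->
    (* Khat = argmax_K ELBO(K) - log(1/pi_K), with pi_K = 1/d *)
    (forall X, (1 <= Khat X <= d)%N /\
       forall K, (1 <= K <= d)%N ->
         (ELBO sigma2 s alpha K X - (ln (d%:R))%:E <=
          ELBO sigma2 s alpha (Khat X) X - (ln (d%:R))%:E)%E) ->
    (intM (fun X : 'M[R]_(n, d) =>
        ((\prod_(i < n) ppca_pdf sigma2 W0 (row i X))%:E *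
         intM (fun W : 'M[R]_(d, Khat X) =>
            (renyi alpha (ppca_pdf sigma2 W) (ppca_pdf sigma2 W0) *
             mf_pdf (rho_mu (Khat X) X) (rho_S (Khat X) X) W)%:E))%E)
     <= (M * ((d * K0)%:R * ln ((d * n)%:R)) / n%:R)%:E)%E.
Proof.
move=> sg0 s0 al01; have /andP[al0 al1] := al01.
set A := `|ln (s ^+ 2)|; set c := C ^+ 2 / s ^+ 2; set c8 := (s ^+ 2)^-1.
have s20 : 0 < s ^+ 2 by rewrite exprn_gt0.
have A0 : 0 <= A by exact: normr_ge0.
have c80 : 0 <= c8 by rewrite invr_ge0 ltW.
have c0 : 0 <= c by rewrite mulr_ge0// sqr_ge0.
have l20 : 0 < ln 2 :> R by rewrite ln_gt0// ltr1n.
have aS0 : 0 < alpha / sigma2 by rewrite divr_gt0.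
set M0 := 3 / 2 + (A / 2 + c + 36 * (alpha / sigma2) + 8 * c8 + 2) / ln 2.
have M00 : 0 < M0 by rewrite addr_gt0 ?divr_gt0//; lra.
exists (M0 / (1 - alpha)); split; first by rewrite divr_gt0// subr_gt0.
move=> d K0 n W0 d1 K01 n2 WC rho_mu rho_S Khat Hrho HK.
have n0 : (0 < n)%N by exact: leq_trans n2.
have K0g : (0 < K0)%N by case/andP: K01.
set L := ln (d * n)%:R; set dk := (d * K0)%:R : R.
have nr1 : 1 <= n%:R :> R by rewrite ler1n.
have dr1 : 1 <= d%:R :> R by rewrite ler1n.
have dk1 : 1 <= dk by rewrite ler1n muln_gt0 d1.
have dn2 : 2 <= (d * n)%:R :> R.
  by rewrite ler_nat (leq_trans n2)// leq_pmull.
have L2 : ln 2 <= L by rewrite ler_ln ?posrE ?ltr0n ?muln_gt0 ?d1.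
have lnd0 : 0 <= ln d%:R :> R by exact: ln_ge0.
have lndL : ln d%:R <= L.
  by rewrite ler_ln ?posrE ?ltr0n ?muln_gt0 ?d1// ler_nat leq_pmulr.
have nd0 : 0 < (n%:R * d%:R : R) by rewrite mulr_gt0; lra.
(* The quadratic loss is of order n d t per entry of [W0] and the entropy cost is half of - ln t.
   This variance makes the first a constant and the second half of [L]. *)
pose t : R := (n%:R * d%:R)^-1.
have t0 : 0 < t by rewrite invr_gt0.
have lnt : - ln t = L by rewrite lnV ?posrE// opprK /L natrM mulrC.
(* g1 + g2 e will bound the deficit of the ELBO, with [e] the exponential weight of the sample that
   replaces the sum of Mahalanobis forms. *)
pose g1 := dk * ((A + L) / 2 + c) + 1 + 8 * (alpha * (n%:R / (2 * sigma2)) + c8) * t * dk.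
pose g2 := 8 * (alpha * (4 * (n%:R * d%:R) / (2 * sigma2))) * t * dk.
have dk0 : 0 <= dk by lra.
have as0 : 0 <= alpha / (2 * sigma2) by rewrite divr_ge0 ?mulr_ge0// ltW.
have g10 : 0 <= g1.
  apply: addr_ge0; first by rewrite addr_ge0// mulr_ge0//; lra.
  apply: mulr_ge0 => //; apply: mulr_ge0; last exact: ltW.
  by apply: mulr_ge0 => //; rewrite addr_ge0// mulrCA mulr_ge0.
have g20 : 0 <= g2.
  apply: mulr_ge0 => //; apply: mulr_ge0; last exact: ltW.
  by apply: mulr_ge0 => //; rewrite mulrCA mulr_ge0// mulr_ge0// ltW.
pose k := (n%:R * (1 - alpha))^-1.
have k0 : 0 < k by rewrite invr_gt0 mulr_gt0 ?subr_gt0//; lra.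
pose T (X : 'M[R]_(n, d)) := \prod_(i < n) tilted sigma2 n W0 (row i X).
(* Models are numbered from 1 and ordinals from 0, hence [K.+1]; the selected model is the term of
   index [(Khat X).-1]. *)
pose H (X : 'M[R]_(n, d)) := (\sum_(K < d) (lhd sigma2 W0 X)%:E * evid sigma2 s alpha K.+1 W0 X)%E.
have H0 X : (0 <= H X)%E.
  apply: sume_ge0 => K _; apply: mule_ge0; last exact: evid_ge0.
  by rewrite lee_fin ltW// lhd_gt0.
have T0 X : 0 <= T X by apply: prodr_ge0 => i _; exact: tilted_ge0.
have pointwise X : ((lhd sigma2 W0 X)%:E *
     intM (fun W : 'M[R]_(d, Khat X) =>
            (renyi alpha (ppca_pdf sigma2 W) (ppca_pdf sigma2 W0) *
             mf_pdf (rho_mu (Khat X) X) (rho_S (Khat X) X) W)%:E) <=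
     (k * (g1 + ln d%:R))%:E * (lhd sigma2 W0 X)%:E +
     ((k * g2)%:E * (T X)%:E + (k / d%:R)%:E * H X))%E.
  have [Kd Kmax] := HK X.
  have [pS EK] := Hrho _ X Kd.
  have [pS0 E0] := Hrho _ X K01.
  have [r1 [r2 [_ _ vE]]] := vobj_hasint alpha sg0 s0 X (rho_mu (Khat X) X) pS.
  have [v0 [v0E v0le]] := vobj_truth sg0 s0 al01 X WC t0.
  have vv0 := elbo_comparison sg0 s0 t0 pS0 E0 v0E vE EK (Kmax _ K01).
  set v := alpha * r1 - r2 in vE vv0.
  have l0 : 0 < lhd sigma2 W0 X by exact: lhd_gt0.
  pose e := \prod_(i < n) expR (qf (prec sigma2 W0) (row i X) / (4 * (n * d)%:R)).
  have e0 : 0 <= e by apply: prodr_ge0 => i _; exact: expR_ge0.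
  have le : lhd sigma2 W0 X * e = T X by rewrite /T /tilted big_split.
  have gX : alpha * loglik sigma2 X W0 - v <= g1 + g2 * e.
    apply: (@le_trans _ _ (alpha * loglik sigma2 X W0 - v0)); first by rewrite lerD2l lerN2.
    apply: (le_trans v0le).
    have := sum_qf_le sigma2 W0 X n0 d1; rewrite -/e natrM; set q := \sum_i _ => qe.
    have tdk : 0 <= t * dk by rewrite mulr_ge0 ?(ltW t0)//; lra.
    have ks : 0 <= 8 * (alpha / (2 * sigma2)) * (t * dk).
      by rewrite !mulr_ge0 ?(ltW al0)// invr_ge0 mulr_ge0// ltW.
    have q' := ler_wpM2l ks qe.
    have lA : ln (s ^+ 2) <= A by exact: ler_norm.
    have lA' : dk * ln (s ^+ 2) <= dk * A by rewrite ler_wpM2l//; lra.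
    rewrite -/dk -/c -/c8 /g1 /g2 lnt.
    exact: truth_arith.
  apply: (@le_trans _ _ ((lhd sigma2 W0 X)%:E * ((k * (g1 + g2 * e + ln d%:R))%:E +
     (k / d%:R)%:E * evid sigma2 s alpha (Khat X) W0 X))%E).
    rewrite lee_pmul2l ?lte_fin//.
    apply: (le_trans (variational_bound sg0 s0 al01 W0 n0 d1 pS vE)).
    rewrite leeD2r// lee_fin ler_pM2l//; lra.
  have kd0 : 0 <= k / d%:R by rewrite divr_ge0// ltW.
  rewrite ge0_muleDr; first 1 last.
  - rewrite lee_fin; apply: mulr_ge0; first exact: ltW.
    by apply: addr_ge0 => //; apply: addr_ge0 => //; exact: mulr_ge0.
  - by rewrite mule_ge0 ?lee_fin//; exact: evid_ge0.
  rewrite addeA; apply: leeD.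
    rewrite -!EFinM -EFinD lee_fin -le.
    exact: weight_arith.
  rewrite muleCA lee_wpmul2l ?lee_fin//.
  have Kp : ((Khat X).-1 < d)%N by case/andP: Kd => K1 K2; rewrite prednK.
  have KE : (Khat X).-1.+1 = Khat X by case/andP: Kd => K1 K2; rewrite prednK.
  rewrite /H (bigD1 (Ordinal Kp))//= KE leeDl// sume_ge0// => K _.
  by apply: mule_ge0; [rewrite lee_fin ltW|exact: evid_ge0].
apply: (le_trans (le_intM pointwise)).
have mlhd : mmeas (fun X : 'M[R]_(n, d) => (lhd sigma2 W0 X)%:E).
  by move=> e Z g mg; apply/measurable_EFinP; exact: measurable_lhd.
have mT : mmeas (fun X : 'M[R]_(n, d) => (T X)%:E).
  move=> e Z g mg; apply/measurable_EFinP; apply: measurable_prod => i _.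
  by apply: measurable_tilted => //; exact: mxmeas_row.
have mlev K : mmeas (fun X : 'M[R]_(n, d) =>
    (lhd sigma2 W0 X)%:E * evid sigma2 s alpha K W0 X)%E.
  move=> e Z g mg; apply: emeasurable_funM; first exact: mlhd.
  exact: mmeas_evid.
have mH : mmeas H.
  by move=> e Z g mg; apply: emeasurable_sum => K; exact: mlev.
have mZ (a : R) (f : 'M[R]_(n, d) -> \bar R) : mmeas f -> mmeas (fun X => a%:E * f X)%E.
  by move=> mf e Z g mg; apply: measurable_funeM; exact: mf.
have lhd0 X : (0 <= (lhd sigma2 W0 X)%:E)%E by rewrite lee_fin ltW// lhd_gt0.
have TE0 X : (0 <= (T X)%:E)%E by rewrite lee_fin.
have kg1 : 0 <= k * (g1 + ln d%:R) by rewrite mulr_ge0 ?(ltW k0)// addr_ge0.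
have kg2 : 0 <= k * g2 by rewrite mulr_ge0// ltW.
have kd0 : 0 <= k / d%:R by rewrite divr_ge0// ltW.
rewrite ge0_intMD; first 1 last.
- exact: mZ.
- by move=> e Z g mg; apply: emeasurable_funD; [exact: (mZ _ _ mT)|exact: (mZ _ _ mH)].
- by move=> X; rewrite mule_ge0.
- by move=> X; rewrite adde_ge0// mule_ge0.
rewrite ge0_intMD; first 1 last.
- exact: mZ.
- exact: mZ.
- by move=> X; rewrite mule_ge0.
- by move=> X; rewrite mule_ge0.
rewrite !ge0_intMZ//.
have -> : intM (fun X : 'M[R]_(n, d) => (lhd sigma2 W0 X)%:E) = 1%E.
  rewrite /lhd (@intM_prod_rows _ _ _ (fun=> ppca_pdf sigma2 W0) (fun=> 1)).
  - by rewrite big1.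
  - move=> i e Z g mg; apply/measurable_EFinP.
    by apply: (@measurable_ppca_pdf _ _ _ _ _ _ _ (fun=> W0)) => //; exact: mxmeas_cst.
  - by move=> i v; rewrite ltW// ppca_pdf_gt0.
  - by move=> i; exact/intRn_gauss_pdf/ppca_cov_posdef.
have -> : intM H = d%:R%:E.
  rewrite /H ge0_intM_sum.
  - under eq_bigr do rewrite expectation_evid//.
    by rewrite sumEFin sumr_const card_ord.
  - by move=> K; exact: mlev.
  - by move=> K X; rewrite mule_ge0//; exact: evid_ge0.
apply: (@le_trans _ _ ((k * (g1 + ln d%:R))%:E * 1 +
    ((k * g2)%:E * 2%:E + (k / d%:R)%:E * d%:R%:E))%E).
  rewrite leeD2l// leeD2r// lee_wpmul2l ?lee_fin//.
  exact: intM_prod_tilted.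
rewrite mule1 -!EFinM -!EFinD lee_fin.
have := risk_constant_le A0 c0 c80 sg0 al0 nr1 dr1 dk1 L2 lndL.
rewrite -/t -/M0 => hM.
have -> : M0 / (1 - alpha) * (dk * L) / n%:R = k * (M0 * (dk * L)).
  by rewrite /k; field; rewrite subr_eq0 !gt_eqF//; lra.
have -> : k * (g1 + ln d%:R) + (k * g2 * 2 + k / d%:R * d%:R) =
    k * (g1 + ln d%:R + 2 * g2 + 1).
  by field; rewrite gt_eqF//; lra.
by rewrite ler_pM2l.
Qed.
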